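(* Let $I=(I_-,I_+)\subset\mathbb R$ be a nonempty open interval with closure $\overline I=[I_-,I_+]\subset[-\infty,\infty]$, and let $\lambda_\pm:\overline I\to[0,\infty)$ be continuous functions such that $\lambda_-$ is nonincreasing, $\lambda_+$ is nondecreasing, $\lambda_-,\lambda_+>0$ on $I$, and $V_{\rm W}<V_{\rm max}$. Assume moreover that $V_{\rm L}<V_{\rm max}$. Then there exists a unique (nonempty open) subinterval $J=(J_-,J_+)$ such that $\overline J\subset I$ and: (i) the unique solution $(f_-,f_+)$ to Luckock's equation on $J$ satisfies $f_-(J_-)=0=f_+(J_+)$; (ii) $\lambda_-<\lambda_-(J_-)$ on $(J_-,J_+]$ and $\lambda_+<\lambda_+(J_+)$ on $[J_-,J_+)$. This subinterval is given by $J=J^{\rm c}$.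
   Context: $V_{\rm max}:=\lambda_-(I_-)\wedge\lambda_+(I_+)$ and $V_{\rm W}:=\sup_{x\in\overline I}\lambda_-(x)\wedge\lambda_+(x)$. The functions $\lambda_-^{-1}:[\lambda_-(I_+),\lambda_-(I_-)]\to\overline I$ and $\lambda_+^{-1}:[\lambda_+(I_-),\lambda_+(I_+)]\to\overline I$ are defined by $$\lambda_-^{-1}(V):=\sup\{x\in\overline I:\lambda_-(x)\ge V\},\qquad \lambda_+^{-1}(V):=\inf\{x\in\overline I:\lambda_+(x)\ge V\}.$$ The function $\Phi:[V_{\rm W},V_{\rm max}]\to[0,\infty]$ is $$\Phi(V):=-\int_{V_{\rm W}}^V\Big\{\frac{1}{\lambda_+(\lambda_-^{-1}(W))}+\frac{1}{\lambda_-(\lambda_+^{-1}(W))}\Big\}\,\mathrm d\Big(\frac1W\Big).$$ Luckock's volume of trade is $V_{\rm L}:=\sup\{V\in[V_{\rm W},V_{\rm max}]:\Phi(V)\le V_{\rm W}^{-2}\}$ and the competitive window is $J^{\rm c}=(J^{\rm c}_-,J^{\rm c}_+):=(\lambda_-^{-1}(V_{\rm L}),\lambda_+^{-1}(V_{\rm L}))$. **Luckock's equation on $J$.** For an interval $J=(J_-,J_+)$ with $\overline J=[J_-,J_+]\subset I$, a solution to Luckock's equation on $J$ is a pair $(f_-,f_+)$ of continuous functions of bounded variation on $\overline J$ such that $f_-\,\mathrm d\lambda_++\lambda_-\,\mathrm df_+=0$ and $f_+\,\mathrm d\lambda_-+\lambda_+\,\mathrm df_-=0$ as signed measures on $\overline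 J$, and $f_-(J_+)=1=f_+(J_-)$. Here $\mathrm df$ is the atomless signed measure with $\mathrm df((x,y])=f(y)-f(x)$ and $g\,\mathrm df$ is $\mathrm df$ weighted with density $g$. Since $\lambda_\pm$ are strictly positive on $\overline J$, it is a fact that there is exactly one solution. *)

(* Defs.v *)
From HB Require Import structures.
From mathcomp Require Import all_boot all_order all_algebra.
From mathcomp Require Import all_classical all_reals all_analysis.
From mathcomp Require Import ring lra.

Set Implicit Arguments.
Unset Strict Implicit.
Unset Printing Implicit Defensive.

Import Order.TTheory GRing.Theory Num.Theory.
Import numFieldNormedType.Exports.

Local Open Scope classical_set_scope.
Local Open Scope ring_scope.

Section stieltjes.
Context {R : realType}.
Implicit Types (a b : R) (f g : R -> R).

(* A signed measure on [a, b] is encoded as a charge on R that does not charge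
   the complement of [a, b]. *)
Definition is_dcharge a b f
    (nu : {charge set (measurableTypeR R) -> \bar R}) : Prop :=
  [/\ forall A : set (measurableTypeR R), measurable A ->
        nu A = nu (A `&` [set` `[a, b]]),
      forall x : R, nu [set x] = 0%E &
      forall x y : R, a <= x -> x <= y -> y <= b ->
        nu [set` `]x, y]] = (f y - f x)%:E].

(* The signed measure df on [a, b]. By dchargeP and is_dcharge_unique it exists
   and is unique when f is continuous and of bounded variation on [a, b]; the
   default value czero is then irrelevant. *)
Definition dcharge a b f : {charge set (measurableTypeR R) -> \bar R} :=
  if pselect (exists nu, is_dcharge a b f nu) is left ex_nu
  then projT1 (cid ex_nu) else czero.

(* The integral against a signed measure, via its Jordan decomposition, which
   does not depend on the Hahn decomposition chosen. *)
Definition charge_integral (nu : {charge set (measurableTypeR R) -> \bar R})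
    (A : set (measurableTypeR R)) (g : R -> \bar R) : \bar R :=
  let P := cid (Hahn_decomposition nu) in
  let N := cid (projT2 P) in
  (\int[jordan_pos (projT2 N)]_(x in A) g x
   - \int[jordan_neg (projT2 N)]_(x in A) g x)%E.

(* The signed measure g df: df weighted with the density g. *)
Definition weighted_dcharge a b g f (A : set (measurableTypeR R)) : \bar R :=
  charge_integral (dcharge a b f) A (EFin \o g).

Definition luckock_solution (lm lp : R -> R) (Jm Jp : R) (fm fp : R -> R) :=
  [/\ {within `[Jm, Jp], continuous fm} /\ {within `[Jm, Jp], continuous fp},
      bounded_variation Jm Jp fm /\ bounded_variation Jm Jp fp,
      forall A : set (measurableTypeR R), measurable A -> A `<=` [set` `[Jm, Jp]] ->
        (weighted_dcharge Jm Jp fm lp A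
         + weighted_dcharge Jm Jp lm fp A = 0)%E,
      forall A : set (measurableTypeR R), measurable A -> A `<=` [set` `[Jm, Jp]] ->
        (weighted_dcharge Jm Jp fp lm A
         + weighted_dcharge Jm Jp lp fm A = 0)%E &
      fm Jp = 1 /\ fp Jm = 1].

End stieltjes.

Section dcharge_properties.
Context {R : realType}.
Implicit Types (a b : R) (f : R -> R).

Let clamp a b (t : R) := Num.max a (Num.min t b).

Let clamp_itv a b t : a <= b -> clamp a b t \in `[a, b].
Proof. by move=> ab; rewrite in_itv/= /clamp le_max lexx/= ge_max ab ge_min lexx orbT. Qed.

Let clamp_id a b t : t \in `[a, b] -> clamp a b t = t.
Proof. by rewrite in_itv/= /clamp => /andP[at_ tb]; rewrite (min_idPl tb) (max_idPr at_). Qed.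

Let clamp_le a b s t : s <= t -> clamp a b s <= clamp a b t.
Proof.
by move=> st; rewrite /clamp ge_max !le_max lexx/= le_min !ge_min st !lexx !orbT.
Qed.

Let continuous_clamp a b f : a <= b -> {within `[a, b], continuous f} ->
  continuous (f \o clamp a b).
Proof.
move=> ab /subspace_continuousP cf x.
have cx : clamp a b @ x --> clamp a b x.
  apply: (@continuous_max _ _ (cst a) (fun t => Num.min t b)); first exact: cvg_cst.
  by apply: (@continuous_min _ _ id (cst b)); [exact: cvg_id|exact: cvg_cst].
have := cf _ (clamp_itv x ab); apply: cvg_comp => U.
rewrite nbhs_simpl/= => /cx; rewrite nbhs_simpl /=; apply: filterS => y; apply.
exact: clamp_itv.
Qed.

Let monotone_measure a b (F : R -> R) :
  {homo F : x y / x <= y} -> continuous F ->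
  exists mu : {finite_measure set (measurableTypeR R) -> \bar R},
  [/\ forall A : set (measurableTypeR R), measurable A ->
        mu A = mu (A `&` [set` `[a, b]]),
      forall x : R, mu [set x] = 0%E &
      forall x y : R, a <= x -> x <= y -> y <= b ->
        mu [set` `]x, y]] = (F y - F x)%:E].
Proof.
move=> ndF cF.
pose G : cumulative R R :=
  HB.pack F (isCumulative.Build R _ R F ndF (right_continuousW cF)).
pose m := lebesgue_stieltjes_measure G.
have moc (x y : R) : x <= y -> m `]x, y]%classic = (F y - F x)%:E.
  move=> xy; transitivity (wlength G `]x, y]%classic).
    by apply: (measurable_mu_extE (wlength G)); exact: is_ocitv.
  exact: wlength_itv_bnd.
have mI (i : interval R) : measurable ([set` i] : set (measurableTypeR R)).
  exact: measurable_itv.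
have m1 (x : R) : m [set x] = 0%E.
  apply/eqP; rewrite eq_le measure_ge0 andbT; apply/lee_addgt0Pr => e e0.
  have /cvgrPdist_lt /(_ _ e0) [d /= d0 xd] := cF x.
  rewrite add0e; apply: (@le_trans _ _ (m `]x - d / 2, x]%classic)).
    apply: le_measure; rewrite ?inE; [exact: measurable_set1|exact: mI|].
    by move=> y /= ->; rewrite in_itv/= lexx andbT; lra.
  rewrite moc; last by lra.
  rewrite lee_fin; apply: ltW; apply: le_lt_trans (xd (x - d / 2) _).
    exact: ler_norm.
  by rewrite /ball_/= opprB addrC subrK ger0_norm; lra.
have mab : measurable ([set` `[a, b]] : set (measurableTypeR R)) := mI _.
have mfin : (m [set` `[a, b]] < +oo)%E.
  apply: (@le_lt_trans _ _ (m `]a - 1, Num.max a b]%classic)).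
    apply: le_measure; rewrite ?inE; [exact: mI|exact: mI|].
    move=> y /=; rewrite !in_itv/= le_max => /andP[ay ->].
    by rewrite orbT andbT; lra.
  by rewrite moc ?ltry// le_max; apply/orP; left; lra.
exists (mfrestr mab mfin); split.
- by move=> A mA; rewrite /= /mfrestr /mrestr -setIA setIid.
- move=> x; apply/eqP; rewrite eq_le measure_ge0 andbT -(m1 x).
  rewrite /= /mfrestr /mrestr; apply: le_measure; rewrite ?inE.
  + by apply: measurableI => //; exact: measurable_set1.
  + exact: measurable_set1.
  + exact: subIsetl.
- move=> x y ax xy yb; rewrite /= /mfrestr /mrestr setIidl.
    exact: moc.
  by move=> z /=; rewrite !in_itv/= => /andP[xz zy]; rewrite (le_trans ax (ltW xz))/= (le_trans zy yb).
Qed.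

Lemma dchargeP a b f : a <= b -> {within `[a, b], continuous f} ->
  bounded_variation a b f -> is_dcharge a b f (dcharge a b f).
Proof.
move=> ab cf bvf; rewrite /dcharge; case: pselect => [h|]; first by case: cid.
case; move: ab; rewrite le_eqVlt => /predU1P[<-{b cf bvf}|ab].
  exists czero; split => // x y ax xy ya; rewrite /czero.
  by have -> : x = y by [lra]; rewrite subrr.
have cTV := total_variation_continuous ab cf bvf.
have key g : {within `[a, b], continuous g} -> bounded_variation a b g ->
    continuous ((fine \o neg_tv a g) \o clamp a b) /\
    {homo ((fine \o neg_tv a g) \o clamp a b) : x y / x <= y}.
  move=> cg bvg; split; last first.
    move=> x y xy; apply: (fine_neg_tv_nondecreasing bvg);
      [exact/clamp_itv/ltW|exact/clamp_itv/ltW|exact: clamp_le].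
  apply: continuous_clamp; first exact: ltW.
  have cT := total_variation_continuous ab cg bvg.
  have E : {in `[a, b], (fun x => 2^-1 * ((fine \o (total_variation a ^~ g)) x - g x))
                    =1 fine \o neg_tv a g}.
    move=> x; rewrite in_itv/= => /andP[ax xb].
    have fT : total_variation a x g \is a fin_num.
      by apply/bounded_variationP => //; exact: bounded_variationl bvg.
    by rewrite /= /neg_tv -(fineK fT) -EFinB -EFinM/= mulrC.
  apply: (@subspace_eq_continuous _ _ _ _ _ _ _).
    by move=> x /set_mem xab; exact: E.
  move=> x; apply: cvgM; first exact: cvg_cst.
  by apply: cvgB; [exact: cT|exact: cg].
have [c1 h1] := key _ cf bvf.
have [c2 h2] : continuous ((fine \o neg_tv a (\- f)) \o clamp a b) /\
    {homo ((fine \o neg_tv a (\- f)) \o clamp a b) : x y / x <= y}.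
  by apply: key; [move=> x; apply: cvgN; exact: cf|exact/bounded_variationN].
have [m1 [s1 a1 e1]] := monotone_measure a b h1 c1.
have [m2 [s2 a2 e2]] := monotone_measure a b h2 c2.
pose nu : {charge set (measurableTypeR R) -> \bar R} :=
  cadd (charge_of_finite_measure m2)
    (cscale (-1) (charge_of_finite_measure m1)).
exists nu.
have E A : nu A = (m2 A - m1 A)%E.
  transitivity (m2 A + (-1)%:E * m1 A)%E; first by [].
  by rewrite EFinN mulN1e.
split.
- by move=> A mA; rewrite !E -s1// -s2.
- by move=> x; rewrite E a1 a2 sube0.
- move=> x y ax xy yb; rewrite E e1// e2// -EFinB/=.
  have xab : x \in `[a, b] by rewrite in_itv/=; lra.
  have yab : y \in `[a, b] by rewrite in_itv/=; lra.
  rewrite !clamp_id// (bounded_variation_pos_neg_tvE bvf xab).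
  rewrite (bounded_variation_pos_neg_tvE bvf yab)/= /pos_tv.
  by congr (_%:E); ring.
Qed.

Let sube_eq0 (x y : \bar R) : y \is a fin_num -> (x - y = 0)%E -> x = y.
Proof. by move=> fy h; rewrite -(subeK x fy) h add0e. Qed.

Lemma is_dcharge_unique a b f (nu1 nu2 : {charge set (measurableTypeR R) -> \bar R}) :
  is_dcharge a b f nu1 -> is_dcharge a b f nu2 ->
  forall A : set (measurableTypeR R), measurable A -> nu1 A = nu2 A.
Proof.
move=> [s1 a1 e1] [s2 a2 e2].
pose nu : {charge set (measurableTypeR R) -> \bar R} := cadd nu1 (cscale (-1) nu2).
have E A : nu A = (nu1 A - nu2 A)%E.
  transitivity (nu1 A + (-1)%:E * nu2 A)%E; first by [].
  by rewrite EFinN mulN1e.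
have mI (i : interval R) : measurable ([set` i] : set (measurableTypeR R)).
  exact: measurable_itv.
have nu_oc (x y : R) : nu `]x, y]%classic = 0%E.
  rewrite E s1// s2//.
  have [yx|xy] := leP y x.
    by rewrite set_itv_ge ?bnd_simp -?leNgt// set0I !charge0 sube0.
  have [ba|ab] := ltP b a.
    by rewrite [`[a, b]%classic]set_itv_ge ?bnd_simp -?ltNge// setI0 !charge0 sube0.
  have key (u v : R) : a <= u -> v <= b -> (nu1 `]u, v]%classic - nu2 `]u, v]%classic = 0)%E.
    move=> au vb; have [uv|vu] := leP u v; first by rewrite e1// e2// -EFinB subrr.
    by rewrite set_itv_ge ?bnd_simp -?leNgt ?ltW// !charge0 sube0.
  have [ax|xa] := leP a x.
    rewrite (_ : _ `&` _ = `]x, Num.min y b]%classic).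
      by apply: key => //; rewrite ge_min lexx orbT.
    apply/seteqP; split=> z /=; rewrite !in_itv/= le_min.
      by move=> [/andP[-> ->] /andP[_ ->]].
    by move=> /and3P[xz -> ->]; rewrite xz (le_trans ax (ltW xz)).
  have [ya|ay] := ltP y a.
    rewrite (_ : _ `&` _ = set0) ?charge0 ?sube0// -subset0 => z /=.
    rewrite !in_itv/= => -[/andP[_ zy] /andP[az _]].
    by move: (le_lt_trans (le_trans az zy) ya); rewrite ltxx.
  rewrite (_ : _ `&` _ = [set a] `|` `]a, Num.min y b]%classic).
    have d : [set a] `&` `]a, Num.min y b]%classic = set0.
      by rewrite -subset0 => z /= [->]; rewrite in_itv/= ltxx.
    rewrite !chargeU//.
    rewrite a1 a2 !add0e; apply: key => //; by rewrite ge_min lexx orbT.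
  apply/seteqP; split=> z /=; rewrite !in_itv/= le_min.
    move=> [/andP[_ ->] /andP[az ->]]; rewrite andbT.
    by move: az; rewrite le_eqVlt => /predU1P[->|->]; [left|right].
  move=> [->|/and3P[az -> ->]]; first by rewrite xa ay lexx ab.
  by rewrite (lt_trans xa az) (ltW az).
have [P [N PN]] := Hahn_decomposition nu.
have fin A : measurable A -> nu A \is a fin_num by exact: fin_num_measure.
have dec A : measurable A -> nu A = (jordan_pos PN A - jordan_neg PN A)%E.
  move=> mA; rewrite (jordan_decomp PN mA).
  transitivity (jordan_pos PN A + (-1)%:E * jordan_neg PN A)%E; first by [].
  by rewrite EFinN mulN1e.
have posneg (A : set (measurableTypeR R)) : measurable A ->
    jordan_pos PN A = jordan_neg PN A -> nu1 A = nu2 A.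
  move=> mA h; have := E A; rewrite dec// h subee ?fin_num_measure// => /esym h0.
  by apply: sube_eq0 h0; exact: fin_num_measure.
move=> A mA; apply: posneg => //; move: A mA.
have eqo (x y : R) : jordan_pos PN `]x, y]%classic = jordan_neg PN `]x, y]%classic.
  have := nu_oc x y; rewrite dec// => h0.
  by apply: sube_eq0 h0; exact: fin_num_measure.
have set_oc : setI_closed (@ocitv R) by exact: ocitvI.
move=> A mA; apply: (@measure_unique _ R (measurableTypeR R) (@ocitv R)
  (fun n => `](- n%:R), n%:R]%classic) erefl set_oc _ _
  (jordan_pos PN) (jordan_neg PN)) => //.
- by move=> n; exact: is_ocitv.
- exact: bigcup_itvT.
- by move=> B [[x y] _ <-]; exact: eqo.
- by move=> n; rewrite -ge0_fin_numE// fin_num_measure.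
Qed.
End dcharge_properties.

(* The suffixes m and p stand for the subscripts - and +; lm and lp are the
   rates lambda_- and lambda_+, defined on the closure [Im, Ip] in \bar R. *)
Section luckock.
Context {R : realType}.
Variables (Im Ip : \bar R) (lm lp : \bar R -> R).

Definition Vmax : R := Num.min (lm Im) (lp Ip).

Definition VW : R := sup [set Num.min (lm x) (lp x) | x in `[Im, Ip]].

Definition lm_inv (V : R) : \bar R :=
  ereal_sup [set x | x \in `[Im, Ip] /\ V <= lm x].

Definition lp_inv (V : R) : \bar R :=
  ereal_inf [set x | x \in `[Im, Ip] /\ V <= lp x].

(* The inverse is that of \bar R, for which 0^-1 = +oo. *)
Definition Phi (V : R) : \bar R :=
  (- charge_integral (dcharge VW V (fun W : R => W^-1%R)) [set` `[VW, V]]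
       (fun W : R => ((lp (lm_inv W))%:E)^-1 + ((lm (lp_inv W))%:E)^-1))%E.

Definition VL : R :=
  sup [set V : R | V \in `[VW, Vmax] /\ (Phi V <= (VW ^- 2)%:E)%E].

Definition competitive_window : \bar R * \bar R := (lm_inv VL, lp_inv VL).

End luckock.

(* Main.v *)
(* Put V = lm J- = lp J+. A solution satisfies fm lp + fp lm = const, and then
   d(fm / lm) = const (1 / lp) d(1 / lm), so it is determined by a primitive G of
   (1 / lp) d(1 / lm) on J, and fm J- = 0 = fp J+ reads G(J+) - G(J-) =
   1 / (V lm(J+)). Substituting W = lm x and W = lp x in Phi turns this into
   Phi V = VW^-2. As Phi is continuous and strictly increasing below Vmax, VL is
   the only such V, and (ii) says that J is the window at level V.

   No Stieltjes calculus is needed: each identity between signed measures is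
   checked on increments over ]x, y] up to an error o(dM) for some nondecreasing
   M, and such errors add up to 0 along finer and finer partitions. *)
From HB Require Import structures.
Require Import Defs.
From mathcomp Require Import all_boot all_order all_algebra.
From mathcomp Require Import all_classical all_reals all_analysis.
From mathcomp Require Import measurable_realfun ring lra.

Set Implicit Arguments.
Unset Strict Implicit.
Unset Printing Implicit Defensive.

Import Order.TTheory GRing.Theory Num.Theory.
Import numFieldNormedType.Exports.

Local Open Scope classical_set_scope.
Local Open Scope ring_scope.

(** * Increments of order o(dM) along partitions *)

Section mesh_negligible.
Context {R : realType}.
Implicit Types (a b c d e : R) (f g M : R -> R) (E k : R -> R -> R).

(** The rates may have plateaus and need not be differentiable, so their inverses can jump and no
    change of variables through derivatives is available. A comparison replaces it: as functions of
    the level W, both [Phi] and the corresponding expression in G have increments over ]x, y] lying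
    between h x and h y times the increment of -1/W, where h is the integrand of [Phi]. Two
    functions enclosed in this way differ by at most the product of the increments of h and -1/W,
    which sums to 0 because -1/W is continuous. Plateaus cost nothing, since 1/lm or 1/lp does not
    change along them.

    Errors are measured by dM rather than by the length y - x because the rates may be singular
    continuous; what matters is only that the increments of M telescope.

    The threshold VW^-2 is a boundary term: it is the value of 1/(lm lp) at a point where lm and lp
    both equal VW.

    The condition VL < Vmax keeps the ends of the window real and inside I. At Vmax an end may reach
    a point where a rate vanishes, and h may become infinite there. *)

Lemma within_continuousE a b f : {within `[a, b], continuous f} <->
  (forall x, x \in `[a, b] -> forall e : R, 0 < e -> exists2 d : R, 0 < d &
    forall y, y \in `[a, b] -> `|y - x| < d -> `|f y - f x| < e).
Proof.
split=> [/subspace_continuousP cf x xab e e0|H].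
  have /cvgrPdist_lt /(_ _ e0) := cf x xab.
  case=> d /= d0 xd; exists d => // y yab yx; rewrite distrC; apply: xd => //.
  by rewrite /ball_/= distrC.
apply/subspace_continuousP => x xab; apply/cvgrPdist_lt => e e0.
have [d d0 xd] := H _ xab _ e0.
exists d => //= y yx yab; rewrite distrC; apply: xd => //.
by rewrite distrC.
Qed.

(** Heine's theorem. By compactness, a property of a radius and a point that holds for points near
    each [x] and radii near 0 from the right holds for all points with one radius. *)
Lemma within_continuous_unif a b f : {within `[a, b], continuous f} ->
  forall e : R, 0 < e -> exists2 d : R, 0 < d & forall x y, x \in `[a, b] ->
    y \in `[a, b] -> `|y - x| < d -> `|f y - f x| <= e.
Proof.
move=> /within_continuousE cf e e0.
have /compact_near_coveringP := @segment_compact R a b.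
move=> /(_ _ (0^'+) (fun d x => x \in `[a, b] -> forall y, y \in `[a, b] ->
  `|y - x| < d -> `|f y - f x| <= e)).
move=> /(_ _) [].
- move=> x xab; have e2 : 0 < e / 2 by lra.
  have [d d0 xd] := cf x xab _ e2.
  exists (ball x (d / 2), [set r | r < d / 2]); first split => /=.
  + by apply: nbhsx_ballx; lra.
  + by apply: nbhs_right_lt; lra.
  move=> [z r] /= [xz rd] zab y yab yz.
  rewrite /ball/= in xz.
  have h1 := xd z zab; have h2 := xd y yab.
  move: xz; rewrite distrC => xz.
  have {}h1 : `|f z - f x| < e / 2 by apply: h1; lra.
  have {}h2 : `|f y - f x| < e / 2.
    apply: h2; rewrite (_ : y - x = (y - z) + (z - x)); last by ring.
    by apply: (le_lt_trans (ler_normD _ _)); lra.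
  rewrite (_ : f y - f z = (f y - f x) - (f z - f x)); last by ring.
  by apply: (le_trans (ler_normB _ _)); lra.
- move=> d /= d0 H; exists (d / 2) => //; first by lra.
  move=> x y xab yab yx.
  apply: (H (d / 2)) => //=; last by lra.
  by rewrite /ball_ /= sub0r normrN ger0_norm; lra.
Qed.

Lemma within_continuous_bounded a b f : a <= b -> {within `[a, b], continuous f} ->
  exists2 K : R, 0 < K & forall x, a <= x -> x <= b -> `|f x| <= K.
Proof.
move=> ab cf; have cf' : {within `[a, b], continuous (fun x => `|f x|)}.
  move=> x; apply: cvg_norm; exact: cf.
have [c _ h] := EVT_max ab cf'.
exists (`|f c| + 1); first by rewrite ltr_wpDl.
move=> x ax xb; apply: (le_trans (h x _)); last by rewrite lerDl.
by rewrite in_itv/= ax.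
Qed.

(* E x y stands for the value of a signed measure on ]x, y]; mesh_negligible means
   E = o(dM) as the mesh of a partition goes to 0. This lets
   Stieltjes differentials be handled as finite increments. *)
Definition mesh_negligible a b E := exists2 M : R -> R,
  {in `[a, b] &, {homo M : x y / x <= y}} &
  forall e : R, 0 < e -> exists2 d : R, 0 < d & forall x y, a <= x -> x <= y -> y <= b ->
    y - x < d -> `|E x y| <= e * (M y - M x).

(** The class O(dM) that goes with o(dM); increments of functions of bounded variation belong to
    it. *)
Definition dominated a b E := exists2 M : R -> R,
  {in `[a, b] &, {homo M : x y / x <= y}} &
  forall x y, a <= x -> x <= y -> y <= b -> `|E x y| <= M y - M x.

Definition vanishing a b k := forall e : R, 0 < e -> exists2 d : R, 0 < d &
  forall x y, a <= x -> x <= y -> y <= b -> y - x < d -> `|k x y| <= e.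

Lemma eq_mesh_negligible a b E E' :
  (forall x y, a <= x -> x <= y -> y <= b -> E x y = E' x y) ->
  mesh_negligible a b E' -> mesh_negligible a b E.
Proof.
move=> EE' [M ndM H]; exists M => // e e0; have [d d0 Hd] := H e e0.
by exists d => // x y ax xy yb xyd; rewrite EE'//; exact: Hd.
Qed.

Lemma le_mesh_negligible a b E E' :
  (forall x y, a <= x -> x <= y -> y <= b -> `|E x y| <= `|E' x y|) ->
  mesh_negligible a b E' -> mesh_negligible a b E.
Proof.
move=> EE' [M ndM H]; exists M => // e e0; have [d d0 Hd] := H e e0.
by exists d => // x y ax xy yb xyd; apply: le_trans (EE' _ _ ax xy yb) _; exact: Hd.
Qed.

Lemma eq_dominated a b E E' :
  (forall x y, a <= x -> x <= y -> y <= b -> E x y = E' x y) ->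
  dominated a b E' -> dominated a b E.
Proof. by move=> EE' [M ndM H]; exists M => // x y ax xy yb; rewrite EE'//; exact: H. Qed.

Lemma homo_itv_le a b M x y : {in `[a, b] &, {homo M : x y / x <= y}} ->
  a <= x -> x <= y -> y <= b -> 0 <= M y - M x.
Proof.
by move=> ndM ax xy yb; rewrite subr_ge0; apply: ndM => //; rewrite in_itv/=; lra.
Qed.

Lemma mesh_negligibleD a b E E' : mesh_negligible a b E -> mesh_negligible a b E' ->
  mesh_negligible a b (fun x y => E x y + E' x y).
Proof.
move=> [M ndM H] [M' ndM' H']; exists (fun x => M x + M' x).
  by move=> x y xab yab xy; apply: lerD; [exact: ndM|exact: ndM'].
move=> e e0; have [d d0 Hd] := H e e0; have [d' d'0 Hd'] := H' e e0.
exists (Num.min d d'); first by rewrite lt_min d0.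
move=> x y ax xy yb; rewrite lt_min => /andP[h h'].
apply: (le_trans (ler_normD _ _)).
by have := Hd _ _ ax xy yb h; have := Hd' _ _ ax xy yb h'; lra.
Qed.

Lemma dominatedD a b E E' : dominated a b E -> dominated a b E' ->
  dominated a b (fun x y => E x y + E' x y).
Proof.
move=> [M ndM H] [M' ndM' H']; exists (fun x => M x + M' x).
  by move=> x y xab yab xy; apply: lerD; [exact: ndM|exact: ndM'].
move=> x y ax xy yb; apply: (le_trans (ler_normD _ _)).
by have := H _ _ ax xy yb; have := H' _ _ ax xy yb; lra.
Qed.

Definition bounded_on a b k := exists2 K : R, 0 < K &
  forall x y, a <= x -> x <= y -> y <= b -> `|k x y| <= K.

Lemma mesh_negligibleM a b k E : bounded_on a b k -> mesh_negligible a b E ->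
  mesh_negligible a b (fun x y => k x y * E x y).
Proof.
move=> [K K0 kK] [M ndM H]; exists (fun x => K * M x).
  by move=> x y xab yab xy; rewrite ler_pM2l//; exact: ndM.
move=> e e0; have [d d0 Hd] := H e e0.
exists d => // x y ax xy yb xyd; rewrite normrM -mulrBr mulrCA.
by apply: ler_pM => //; [exact: kK|exact: Hd].
Qed.

Lemma dominatedM a b k E : bounded_on a b k -> dominated a b E ->
  dominated a b (fun x y => k x y * E x y).
Proof.
move=> [K K0 kK] [M ndM H]; exists (fun x => K * M x).
  by move=> x y xab yab xy; rewrite ler_pM2l//; exact: ndM.
move=> x y ax xy yb; rewrite normrM -mulrBr.
by apply: ler_pM => //; [exact: kK|exact: H].
Qed.

(** This discards second-order terms: when [k] is the increment of a continuous function and [E]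
    that of a function of bounded variation, their product drops out of every product rule. *)
Lemma mesh_negligible_vanishing a b k E : vanishing a b k -> dominated a b E ->
  mesh_negligible a b (fun x y => k x y * E x y).
Proof.
move=> vk [M ndM H]; exists M => // e e0.
have [d d0 Hd] := vk e e0; exists d => // x y ax xy yb xyd.
by rewrite normrM; apply: ler_pM => //; [exact: Hd|exact: H].
Qed.

Lemma vanishing_continuous a b f : {within `[a, b], continuous f} ->
  vanishing a b (fun x y => f y - f x).
Proof.
move=> cf e e0; have [d d0 H] := within_continuous_unif cf e0.
exists d => // x y ax xy yb yxd; apply: H; rewrite ?in_itv/=; [lra|lra|].
by rewrite ger0_norm//; lra.
Qed.

Lemma dominated_nondecreasing a b f : {in `[a, b] &, {homo f : x y / x <= y}} ->
  dominated a b (fun x y => f y - f x).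
Proof.
by move=> ndf; exists f => // x y ax xy yb; rewrite ger0_norm// (homo_itv_le ndf).
Qed.

Lemma dominated_nonincreasing a b f : {in `[a, b] &, {homo f : x y / x <= y >-> y <= x}} ->
  dominated a b (fun x y => f y - f x).
Proof.
move=> nif; exists (fun x => - f x).
  by move=> x y xab yab xy; rewrite lerN2; exact: nif.
move=> x y ax xy yb; have : f y <= f x by apply: nif => //; rewrite in_itv/=; lra.
by move=> fyx; rewrite distrC ger0_norm; lra.
Qed.

Lemma bounded_onl a b f : a <= b -> {within `[a, b], continuous f} ->
  bounded_on a b (fun x y => f x).
Proof.
move=> ab /(within_continuous_bounded ab)[K K0 fK]; exists K => // x y ax xy yb.
by apply: fK => //; exact: le_trans yb.
Qed.

Lemma bounded_onr a b f : a <= b -> {within `[a, b], continuous f} ->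
  bounded_on a b (fun x y => f y).
Proof.
move=> ab /(within_continuous_bounded ab)[K K0 fK]; exists K => // x y ax xy yb.
by apply: fK => //; exact: le_trans xy.
Qed.

Lemma bounded_onM a b k k' : bounded_on a b k -> bounded_on a b k' ->
  bounded_on a b (fun x y => k x y * k' x y).
Proof.
move=> [K K0 kK] [K' K'0 kK']; exists (K * K'); first exact: mulr_gt0.
by move=> x y ax xy yb; rewrite normrM; apply: ler_pM => //; [exact: kK|exact: kK'].
Qed.

Lemma bounded_on_cst a b (c : R) : bounded_on a b (fun _ _ => c).
Proof.
by exists (`|c| + 1) => [|x y _ _ _]; [rewrite ltr_wpDl|rewrite lerDl].
Qed.

Lemma bounded_onN a b k : bounded_on a b k -> bounded_on a b (fun x y => - k x y).
Proof. by move=> [K K0 kK]; exists K => // x y ax xy yb; rewrite normrN; exact: kK. Qed.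

(** The bound by dM makes [f + M] nondecreasing, so [f] is a difference of two nondecreasing
    functions. *)
Lemma dominated_bounded_variation a b f : a < b ->
  dominated a b (fun x y => f y - f x) -> bounded_variation a b f.
Proof.
move=> ab [M ndM H].
have -> : f = (fun x => f x + M x) \+ (fun x => - M x).
  by apply/funext => x /=; rewrite addrK.
apply: bounded_variationD => //; last first.
  exact/bounded_variationN/nondecreasing_bounded_variation.
apply: nondecreasing_bounded_variation => x y; rewrite !in_itv/= => xab yab xy.
have : `|f y - f x| <= M y - M x by apply: H; lra.
by rewrite ler_norml => /andP[h _]; lra.
Qed.

(* Additivity over the partition of [a, b] into n equal parts. *)
Lemma le_of_mesh_negligible a b f E : a <= b -> mesh_negligible a b E ->
  (forall x y, a <= x -> x <= y -> y <= b -> E x y <= f y - f x) -> f a <= f b.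
Proof.
move=> ab [M ndM H] Ef; apply/ler_addgt0Pl => e e0.
have Mab : 0 <= M b - M a by exact: homo_itv_le ndM _ _ _.
(* The errors of all parts telescope to [e' * (M b - M a)], which is at most [e]; the [+ 1] covers a
   constant [M]. *)
pose e' := e / (M b - M a + 1).
have e'0 : 0 < e' by rewrite divr_gt0//; lra.
have [d d0 Hd] := H e' e'0.
pose n := (Num.truncn ((b - a) / d)).+1.
have nlt : (b - a) / d < n%:R.
  by rewrite /n; apply: truncnS_gt.
have n0 : 0 < n%:R :> R by rewrite ltr0n.
pose h := (b - a) / n%:R.
have h0 : 0 <= h by rewrite divr_ge0//; lra.
have hd : h < d by rewrite /h ltr_pdivrMr// mulrC -ltr_pdivrMr.
have hn : a + n%:R * h = b by rewrite /h mulrC divfK ?gt_eqF//; ring.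
suff key (k : nat) : (k <= n)%N -> - (e' * (M (a + k%:R * h) - M a)) <= f (a + k%:R * h) - f a.
  have := key n (leqnn _); rewrite hn => h1.
  have : e' * (M b - M a) <= e.
    rewrite /e' mulrAC ler_pdivrMr; last by lra.
    by rewrite ler_pM2l//; lra.
  by lra.
elim: k => [_|k ih kn]; first by rewrite mul0r addr0 !subrr mulr0 oppr0.
have {}ih := ih (ltnW kn).
have ax : a <= a + k%:R * h by rewrite lerDl mulr_ge0.
have xy : a + k%:R * h <= a + k.+1%:R * h.
  by rewrite lerD2l ler_wpM2r// ler_nat.
have yb : a + k.+1%:R * h <= b by rewrite -[leRHS]hn lerD2l ler_wpM2r// ler_nat.
have := Hd _ _ ax xy yb; rewrite -natr1 in xy yb *.
have -> : a + (k%:R + 1) * h - (a + k%:R * h) = h by ring.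
move=> /(_ hd); rewrite ler_norml => /andP[h1 _].
by have := Ef _ _ ax xy yb; lra.
Qed.

Lemma mesh_negligible_sub a b c d E : a <= c -> d <= b -> mesh_negligible a b E -> mesh_negligible c d E.
Proof.
move=> ac db [M ndM H]; exists M.
  move=> x y; rewrite !in_itv/= => /andP[cx xd] /andP[cy yd].
  by apply: ndM; rewrite in_itv/=; lra.
move=> e e0; have [r r0 Hr] := H e e0; exists r => // x y cx xy yd.
by apply: Hr => //; lra.
Qed.

(** The principle that concludes most identities below. Both inequalities come from
    [le_of_mesh_negligible], applied to [f] and to its opposite. *)
Lemma mesh_negligible_cst a b f : mesh_negligible a b (fun x y => f y - f x) ->
  {in `[a, b] &, forall x y, f x = f y}.
Proof.
move=> nf; suff H x y : x \in `[a, b] -> y \in `[a, b] -> x <= y -> f x = f y.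
  by move=> x y xab yab; case: (leP x y) => [/H|/ltW /H ->//]; exact.
rewrite !in_itv/= => /andP[ax _] /andP[_ yb] xy.
have nf' : mesh_negligible x y (fun x y => f y - f x) by exact: mesh_negligible_sub nf.
apply/eqP; rewrite eq_le (le_of_mesh_negligible xy nf')//=.
rewrite -lerN2; apply: (@le_of_mesh_negligible _ _ (fun x => - f x)
  (fun x y => -1 * (f y - f x))) => //.
  by apply: mesh_negligibleM => //; exact: bounded_on_cst.
by move=> u v _ _ _; lra.
Qed.

End mesh_negligible.

(** * Densities with respect to signed measures *)

Section weighted_charge.
Context {R : realType}.
Implicit Types (a b : R) (f g : R -> R).
Local Notation mR := (measurableTypeR R).

Lemma measurable_itvR (i : interval R) : measurable ([set` i] : set mR).
Proof. exact: measurable_itv. Qed.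

Lemma ocitv_subset a b (x y : R) : a <= x -> y <= b ->
  `]x, y]%classic `<=` `[a, b]%classic.
Proof. by move=> ax yb z /=; rewrite !in_itv/= => /andP[xz zy]; lra. Qed.

Lemma integrable_within_continuous (mu : {finite_measure set mR -> \bar R}) a b g :
  a <= b -> {within `[a, b], continuous g} -> mu.-integrable `[a, b] (EFin \o g).
Proof.
move=> ab cg; apply: (@measurable_bounded_integrable _ _ _ mu g).
- exact: measurable_itvR.
- by rewrite -ge0_fin_numE//; apply: fin_num_measure; exact: measurable_itvR.
- apply: subspace_continuous_measurable_fun => //; exact: measurable_itvR.
- have [K K0 gK] := within_continuous_bounded ab cg.
  exists K; split; first exact: num_real.
  move=> r Kr x /=; rewrite in_itv/= => /andP[ax xb].
  exact/(le_trans _ (ltW Kr))/gK.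
Qed.

(** The last property is a first-order expansion: by uniform continuity [g] oscillates by at most
    [e] on a short []x, y]], so replacing it there by [g x] costs at most [e] times the mass. *)
Lemma finite_measure_density (mu : {finite_measure set mR -> \bar R}) a b g :
  a <= b -> {within `[a, b], continuous g} ->
  exists c : {charge set mR -> \bar R},
  [/\ forall A, measurable A -> c A = c (A `&` [set` `[a, b]]),
      forall A, measurable A -> A `<=` [set` `[a, b]] ->
        c A = (\int[mu]_(x in A) (g x)%:E)%E &
      forall e : R, 0 < e -> exists2 d : R, 0 < d & forall x y, a <= x -> x <= y -> y <= b ->
        y - x < d -> `|fine (c `]x, y]%classic) - g x * fine (mu `]x, y]%classic)|
          <= e * fine (mu `]x, y]%classic)].
Proof.
move=> ab cg; have ig := integrable_within_continuous mu ab cg.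
have mab : measurable ([set` `[a, b]] : set mR) by exact: measurable_itvR.
have ig' : mu.-integrable setT ((EFin \o g) \_ `[a, b]).
  by apply/(integrable_mkcond _ mab).
pose c : {charge set mR -> \bar R} := induced_charge ig'.
have cE (A : set mR) : measurable A -> A `<=` [set` `[a, b]] ->
    c A = (\int[mu]_(x in A) (g x)%:E)%E.
  move=> mA Aab; rewrite /c/= /induced_charge.
  by apply: eq_integral => x /set_mem Ax; rewrite patchE mem_set//; exact: Aab.
exists c; split => //.
- move=> A mA; rewrite /c/= /induced_charge.
  rewrite -integral_mkcondr.
  rewrite -[RHS]integral_mkcondr -setIA setIid//.
- move=> e e0; have [d d0 H] := within_continuous_unif cg e0.
  exists d => // x y ax xy yb xyd.
  have mxy : measurable (`]x, y]%classic : set mR) by exact: measurable_itvR.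
  have sxy : `]x, y]%classic `<=` `[a, b]%classic by exact: ocitv_subset.
  rewrite cE//.
  have fmu : mu `]x, y]%classic \is a fin_num by exact: fin_num_measure.
  have igxy : mu.-integrable `]x, y]%classic (EFin \o g) by exact: integrableS ig.
  have icst (r : R) : mu.-integrable `]x, y]%classic (EFin \o cst r).
    exact: finite_measure_integrable_cst.
  have h : mu.-integrable `]x, y] (EFin \o (fun t => g t - g x)).
    exact: (integrableB mxy igxy (icst (g x))).
  have -> : fine (\int[mu]_(t in `]x, y]) (g t)%:E)%E - g x * fine (mu `]x, y]%classic) =
      \int[mu]_(t in `]x, y]) (g t - g x).
    rewrite [RHS](RintegralB mxy igxy (icst (g x))).
    by rewrite [X in _ = _ - X]Rintegral_cst.
  apply: (le_trans (le_normr_Rintegral mxy h)).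
  rewrite -[leRHS](Rintegral_cst mu mxy e); apply: le_Rintegral => //.
  + exact: integrable_norm.
  + exact: icst.
  + move=> t /=; rewrite in_itv/= => /andP[xt ty].
    apply: H; rewrite ?in_itv/=; [lra|lra|].
    by rewrite ger0_norm; lra.
Qed.

(** A singleton lies inside [P] or misses it, so its positive part is [nu [set x]] or 0. *)
Lemma jordan_pos_set1 (nu : {charge set mR -> \bar R}) P N
    (PN : hahn_decomposition nu P N) (x : R) :
  nu [set x] = 0%E -> jordan_pos PN [set x] = 0%E.
Proof.
move=> nux; rewrite jordan_posE cjordan_posE /crestr0 mem_set; last exact: measurable_set1.
rewrite /crestr; have [xP|xP] := pselect (P x).
  by rewrite setIidl// => _ ->.
rewrite (_ : _ `&` _ = set0) ?charge0//.
by rewrite -subset0 => _ [/= ->].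
Qed.

Lemma jordan_neg_set1 (nu : {charge set mR -> \bar R}) P N
    (PN : hahn_decomposition nu P N) (x : R) :
  nu [set x] = 0%E -> jordan_neg PN [set x] = 0%E.
Proof.
move=> nux; have := jordan_decomp PN (measurable_set1 x).
rewrite nux /cadd/= /cscale jordan_pos_set1// add0e EFinN mulN1e => /esym/eqP.
by rewrite oppe_eq0 => /eqP.
Qed.

(** [weighted_dcharge] is a mere set function. Here it is realised by a charge, to which uniqueness
    of charges applies, and tied to the increments of [f]: the expansions for the two Jordan parts
    are subtracted. *)
Lemma dcharge_density a b f g : a <= b -> {within `[a, b], continuous f} ->
  bounded_variation a b f -> {within `[a, b], continuous g} ->
  exists c : {charge set mR -> \bar R},
  [/\ forall A, measurable A -> c A = c (A `&` [set` `[a, b]]),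
      forall x, c [set x] = 0%E,
      forall A, measurable A -> A `<=` [set` `[a, b]] -> c A = weighted_dcharge a b g f A &
      mesh_negligible a b (fun x y => fine (c `]x, y]%classic) - g x * (f y - f x))].
Proof.
move=> ab cf bvf cg; have [dS d1 dE] := dchargeP ab cf bvf.
rewrite /weighted_dcharge /charge_integral.
set nu := dcharge a b f in dS d1 dE *.
set PN := projT2 (cid (projT2 (cid (Hahn_decomposition nu)))).
have [cp [cpS cpE cpA]] := finite_measure_density (jordan_pos PN) ab cg.
have [cn [cnS cnE cnA]] := finite_measure_density (jordan_neg PN) ab cg.
pose c : {charge set mR -> \bar R} := cadd cp (cscale (-1) cn).
have cE A : c A = (cp A - cn A)%E.
  by transitivity (cp A + (-1)%:E * cn A)%E => //; rewrite EFinN mulN1e.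
exists c; split.
- by move=> A mA; rewrite !cE -cpS// -cnS.
- move=> x; have mx := @measurable_set1 R x.
  rewrite cE cpS// cnS//.
  rewrite cpE ?cnE; [|by apply: measurableI => //; exact: measurable_itvR|by []
    |by apply: measurableI => //; exact: measurable_itvR|by []].
  have null (mu : {finite_measure set mR -> \bar R}) : mu [set x] = 0%E ->
      (\int[mu]_(y in [set x] `&` [set` `[a, b]]) (g y)%:E = 0)%E.
    move=> mux; apply: null_set_integral.
    + by apply: measurableI => //; exact: measurable_itvR.
    + have /integrableP[mg _] := integrable_within_continuous mu ab cg.
      by apply: measurable_funS mg => //; exact: measurable_itvR.
    + apply/eqP; rewrite eq_le measure_ge0 andbT -mux.
      by apply: le_measure; rewrite ?inE//; apply: measurableI => //; exact: measurable_itvR.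
  rewrite (null _ (jordan_pos_set1 PN (d1 x))) (null _ (jordan_neg_set1 PN (d1 x))).
  by rewrite sube0.
- by move=> A mA Aab; rewrite cE cpE// cnE.
(* The distribution function of the total variation of df, which controls both error terms. *)
pose M t := fine (jordan_pos PN `]a, t]%classic) + fine (jordan_neg PN `]a, t]%classic).
have mitv (s t : R) : measurable (`]s, t]%classic : set mR) by exact: measurable_itvR.
have add (mu : {finite_measure set mR -> \bar R}) x y : a <= x -> x <= y ->
    fine (mu `]a, y]%classic) = fine (mu `]a, x]%classic) + fine (mu `]x, y]%classic).
  move=> ax xy; rewrite -fineD ?fin_num_measure// -measureU//.
    by rewrite -itv_bndbnd_setU ?bnd_simp.
  rewrite -subset0 => z [] /=; rewrite !in_itv/= => /andP[_ zx] /andP[xz _].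
  by move: (lt_le_trans xz zx); rewrite ltxx.
exists M.
  move=> x y; rewrite !in_itv/= => /andP[ax _] _ xy.
  by rewrite /M !(add _ x y)//; apply: lerD; rewrite lerDl fine_ge0.
move=> e e0; have [d d0 Hd] := cpA _ e0; have [d' d'0 Hd'] := cnA _ e0.
exists (Num.min d d'); first by rewrite lt_min d0.
move=> x y ax xy yb; rewrite lt_min => /andP[h h'].
rewrite /M !(add _ x y)//.
have := Hd _ _ ax xy yb h; have := Hd' _ _ ax xy yb h'.
have -> : f y - f x = fine (jordan_pos PN `]x, y]%classic) - fine (jordan_neg PN `]x, y]%classic).
  have := dE _ _ ax xy yb; rewrite (jordan_decomp PN (mitv x y)) /cadd/= /cscale.
  move=> /(congr1 fine) /= <-; rewrite EFinN mulN1e fineB//; exact: fin_num_measure.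
rewrite cE fineB ?fin_num_measure//.
set p := fine (jordan_pos _ _); set n := fine (jordan_neg _ _).
move: (fine (cp _)) (fine (cn _)) => u v.
move=> H1 H2; rewrite (_ : _ - _ = (u - g x * p) - (v - g x * n)); last by ring.
by apply: (le_trans (ler_normB _ _)); lra.
Qed.

Lemma charge_ocitvB (c : {charge set mR -> \bar R}) (a x y : R) : a <= x -> x <= y ->
  fine (c `]x, y]%classic) = fine (c `]a, y]%classic) - fine (c `]a, x]%classic).
Proof.
move=> ax xy.
have mitv (s t : R) : measurable (`]s, t]%classic : set mR) by exact: measurable_itvR.
have -> : c `]a, y]%classic = (c `]a, x]%classic + c `]x, y]%classic)%E.
  rewrite -chargeU//; first by rewrite -itv_bndbnd_setU ?bnd_simp.
  rewrite -subset0 => z [] /=; rewrite !in_itv/= => /andP[_ zx] /andP[xz _].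
  by move: (lt_le_trans xz zx); rewrite ltxx.
by rewrite fineD ?fin_num_measure// addrC addKr.
Qed.

(** The distribution function of [c] has negligible increments, hence is constant. So [c] and the
    zero charge both represent the differential of a constant, and such a charge is unique. *)
Lemma charge_eq0 a b (c : {charge set mR -> \bar R}) : a <= b ->
  (forall A, measurable A -> c A = c (A `&` [set` `[a, b]])) ->
  (forall x, c [set x] = 0%E) ->
  mesh_negligible a b (fun x y => fine (c `]x, y]%classic)) ->
  forall A : set mR, measurable A -> c A = 0%E.
Proof.
move=> ab cS c1 cn A mA.
pose F t := fine (c `]a, t]%classic).
have FB x y : a <= x -> x <= y -> fine (c `]x, y]%classic) = F y - F x.
  exact: charge_ocitvB.
have nF : mesh_negligible a b (fun x y => F y - F x).
  by apply: eq_mesh_negligible cn => x y ax xy yb; rewrite FB.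
have dc : is_dcharge a b (cst 0) c.
  split => // x y ax xy yb; rewrite subrr -[LHS]fineK ?fin_num_measure// FB//.
  congr EFin; apply/eqP; rewrite subr_eq0; apply/eqP.
  by apply: (mesh_negligible_cst nF); rewrite in_itv/=; lra.
have d0 : is_dcharge a b (cst 0) (czero : {charge set mR -> \bar R}).
  by split => // x y ax xy yb; rewrite subrr.
by rewrite (is_dcharge_unique dc d0).
Qed.

End weighted_charge.

(** * Measure identities and Stieltjes primitives in terms of increments *)

Section luckock_solutions.
Context {R : realType}.
Implicit Types (a b : R) (f g p q G : R -> R).
Local Notation mR := (measurableTypeR R).

(** If the two charges cancel, only the expansion errors remain; conversely, negligible increments
    make the sum of the charges negligible on every []x, y]], hence zero by [charge_eq0]. *)
Lemma weighted_dcharge_add0P a b f g f' g' : a <= b ->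
  {within `[a, b], continuous f} -> {within `[a, b], continuous g} ->
  {within `[a, b], continuous f'} -> {within `[a, b], continuous g'} ->
  bounded_variation a b f -> bounded_variation a b f' ->
  (forall A : set mR, measurable A -> A `<=` [set` `[a, b]] ->
    (weighted_dcharge a b g f A + weighted_dcharge a b g' f' A = 0)%E) <->
  mesh_negligible a b (fun x y => g x * (f y - f x) + g' x * (f' y - f' x)).
Proof.
move=> ab cf cg cf' cg' bvf bvf'.
have [c [cS c1 cE cn]] := dcharge_density ab cf bvf cg.
have [c' [cS' c1' cE' cn']] := dcharge_density ab cf' bvf' cg'.
have mitv (s t : R) : measurable (`]s, t]%classic : set mR) by exact: measurable_itvR.
have nn := mesh_negligibleM (bounded_on_cst a b (-1)) (mesh_negligibleD cn cn').
split=> [H|H A mA Aab].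
  apply: eq_mesh_negligible nn => x y ax xy yb.
  have : fine (c `]x, y]%classic) + fine (c' `]x, y]%classic) = 0.
    have sxy := ocitv_subset ax yb.
    rewrite -fineD ?fin_num_measure// cE// cE'// H//.
  by lra.
pose s : {charge set mR -> \bar R} := cadd c c'.
have sE B : s B = (c B + c' B)%E by [].
rewrite -cE// -cE'// -sE; apply: (charge_eq0 ab) => //.
- by move=> B mB; rewrite !sE cS// cS'.
- by move=> x; rewrite sE c1 c1' adde0.
- apply: eq_mesh_negligible (mesh_negligibleD (mesh_negligibleD cn cn') H) => x y ax xy yb.
  by rewrite sE fineD ?fin_num_measure//; lra.
Qed.

(** For [p] continuous and nonincreasing and [q] nondecreasing, this says that [G] is a primitive of
    p dq, expressed without an integral. *)
Definition stieltjes_sandwich a b p q G := forall x y, a <= x -> x <= y -> y <= b ->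
  p y * (q y - q x) <= G y - G x <= p x * (q y - q x).

(** [G] is the distribution function of the charge p dq. Its increments are [p s] times those of [q]
    up to negligible errors, and [p s] lies between [p y] and [p x] inside [[x, y]];
    [le_of_mesh_negligible] carries both bounds over to the whole of []x, y]]. *)
Lemma stieltjes_sandwich_exists a b p q : a <= b ->
  {within `[a, b], continuous p} -> {within `[a, b], continuous q} ->
  {in `[a, b] &, {homo p : x y / x <= y >-> y <= x}} ->
  {in `[a, b] &, {homo q : x y / x <= y}} ->
  exists G, stieltjes_sandwich a b p q G.
Proof.
move=> ab cp cq nip ndq.
have bvq := nondecreasing_bounded_variation ndq.
have [c [_ _ _ cn]] := dcharge_density ab cq bvq cp.
pose G x := fine (c `]a, x]%classic).
exists G => x y ax xy yb.
have cn' : mesh_negligible x y (fun x y => fine (c `]x, y]%classic) - p x * (q y - q x)).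
  exact: mesh_negligible_sub cn.
have mono s t : x <= s -> s <= t -> t <= y -> [/\ p s <= p x, p y <= p s & 0 <= q t - q s].
  move=> xs st ty; split; [apply: nip|apply: nip|rewrite subr_ge0; apply: ndq] => //;
    rewrite ?in_itv/=; lra.
have GB s t : x <= s -> s <= t -> fine (c `]s, t]%classic) = G t - G s.
  by move=> xs st; rewrite -charge_ocitvB//; lra.
apply/andP; split.
  have := @le_of_mesh_negligible _ _ _ (fun t => G t - p y * q t) _ xy cn'.
  suff h : forall s t, x <= s -> s <= t -> t <= y ->
      fine (c `]s, t]%classic) - p s * (q t - q s) <= G t - p y * q t - (G s - p y * q s).
    by move/(_ h); lra.
  move=> s t xs st ty; have [_ h1 h2] := mono s t xs st ty.
  by rewrite GB//; have := ler_wpM2r h2 h1; lra.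
have nn := mesh_negligibleM (bounded_on_cst x y (-1)) cn'.
have := @le_of_mesh_negligible _ _ _ (fun t => p x * q t - G t) _ xy nn.
suff h : forall s t, x <= s -> s <= t -> t <= y ->
    -1 * (fine (c `]s, t]%classic) - p s * (q t - q s)) <= p x * q t - G t - (p x * q s - G s).
  by move/(_ h); lra.
move=> s t xs st ty; have [h1 _ h2] := mono s t xs st ty.
by rewrite GB//; have := ler_wpM2r h2 h1; lra.
Qed.

(** The two bounds of the sandwich differ by the second-order term dp dq. *)
Lemma stieltjes_sandwich_negligible a b p q G : {within `[a, b], continuous p} ->
  {in `[a, b] &, {homo q : x y / x <= y}} -> stieltjes_sandwich a b p q G ->
  mesh_negligible a b (fun x y => (G y - G x) - p x * (q y - q x)).
Proof.
move=> cp ndq sG.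
apply: le_mesh_negligible (mesh_negligible_vanishing (vanishing_continuous cp)
  (dominated_nondecreasing ndq)) => x y ax xy yb.
have /andP[h1 h2] := sG _ _ ax xy yb.
rewrite ler0_norm; last by lra.
by rewrite -normrN; apply: le_trans (ler_norm _); lra.
Qed.

(* h may jump: P and Q differ on ]x, y] by at most dF dh, and F is continuous. *)
Lemma sandwich_unique a b (h F P Q : R -> R) : a <= b -> {within `[a, b], continuous F} ->
  {in `[a, b] &, {homo h : x y / x <= y}} ->
  (forall x y, a <= x -> x <= y -> y <= b ->
    h x * (F y - F x) <= P y - P x <= h y * (F y - F x)) ->
  (forall x y, a <= x -> x <= y -> y <= b ->
    h x * (F y - F x) <= Q y - Q x <= h y * (F y - F x)) ->
  P b - P a = Q b - Q a.
Proof.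
move=> ab cF ndh sP sQ.
have n : mesh_negligible a b (fun x y => (P y - Q y) - (P x - Q x)).
  apply: le_mesh_negligible (mesh_negligible_vanishing (vanishing_continuous cF)
    (dominated_nondecreasing ndh)) => x y ax xy yb.
  have /andP[h1 h2] := sP _ _ ax xy yb; have /andP[h3 h4] := sQ _ _ ax xy yb.
  have h5 : 0 <= (F y - F x) * (h y - h x) by lra.
  by rewrite (ger0_norm h5) ler_norml; apply/andP; split; lra.
have := mesh_negligible_cst n; move=> /(_ b a); rewrite !in_itv/= !lexx ab.
by move=> /(_ erefl erefl); lra.
Qed.

End luckock_solutions.

Lemma within_continuousV (R : realType) (a b : R) (f : R -> R) : {within `[a, b], continuous f} ->
  (forall x, a <= x -> x <= b -> 0 < f x) ->
  {within `[a, b], continuous (fun x => (f x)^-1)}.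
Proof.
move=> /subspace_continuousP cf f0; apply/subspace_continuousP => x xab.
apply: cvgV; last exact: cf.
by move: xab; rewrite /= in_itv/= => /andP[ax xb]; rewrite gt_eqF// f0.
Qed.

(** * Solutions of Luckock's equation on a fixed interval *)

Section luckock_on_interval.
Context {R : realType}.
Variables (a b : R) (lm lp G : R -> R).
Hypotheses (ab : a < b) (clm : {within `[a, b], continuous lm})
  (clp : {within `[a, b], continuous lp})
  (lm0 : forall x, a <= x -> x <= b -> 0 < lm x)
  (lp0 : forall x, a <= x -> x <= b -> 0 < lp x)
  (nilm : {in `[a, b] &, {homo lm : x y / x <= y >-> y <= x}})
  (ndlp : {in `[a, b] &, {homo lp : x y / x <= y}})
  (sG : stieltjes_sandwich a b (fun x => (lp x)^-1) (fun x => (lm x)^-1) G).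

Let leab := ltW ab.

Let bvlp : bounded_variation a b lp := nondecreasing_bounded_variation ndlp.

Let dlm := dominated_nonincreasing nilm.
Let dlp := dominated_nondecreasing ndlp.

Let bvlm : bounded_variation a b lm := dominated_bounded_variation ab dlm.

Lemma luckock_solutionP fm fp : luckock_solution lm lp a b fm fp <->
  [/\ {within `[a, b], continuous fm} /\ {within `[a, b], continuous fp},
      bounded_variation a b fm /\ bounded_variation a b fp,
      mesh_negligible a b (fun x y => fm x * (lp y - lp x) + lm x * (fp y - fp x)),
      mesh_negligible a b (fun x y => fp x * (lm y - lm x) + lp x * (fm y - fm x)) &
      fm b = 1 /\ fp a = 1].
Proof.
split=> -[[cfm cfp] [bvfm bvfp] h1 h2 h3]; split => //.
- by apply/(weighted_dcharge_add0P leab clp cfm cfp clm bvlp bvfp).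
- by apply/(weighted_dcharge_add0P leab clm cfp cfm clp bvlm bvfm).
- by apply/(weighted_dcharge_add0P leab clp cfm cfp clm bvlp bvfp).
- by apply/(weighted_dcharge_add0P leab clm cfp cfm clp bvlm bvfm).
Qed.

Let cvlm := within_continuousV clm lm0.
Let cvlp := within_continuousV clp lp0.

Lemma homo_rateV_lm : {in `[a, b] &, {homo (fun x => (lm x)^-1) : x y / x <= y}}.
Proof.
move=> x y xab yab xy; move: (xab) (yab); rewrite !in_itv/= => /andP[ax xb] /andP[ay yb].
by rewrite lef_pV2 ?posrE ?lm0//; exact: nilm.
Qed.

Let negG : mesh_negligible a b
  (fun x y => (G y - G x) - (lp x)^-1 * ((lm y)^-1 - (lm x)^-1)).
Proof. exact: stieltjes_sandwich_negligible cvlp homo_rateV_lm sG. Qed.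

(** The sum of the two equations is the product rule for [fm x * lp x + fp x * lm x], up to the
    second-order terms dfm dlp and dfp dlm. The constant is evaluated at [a], where [fp a = 1]. *)
Lemma luckock_solution_conserved fm fp : luckock_solution lm lp a b fm fp ->
  forall x, a <= x -> x <= b -> fm x * lp x + fp x * lm x = fm a * lp a + lm a.
Proof.
move=> /luckock_solutionP [[cfm cfp] _ h1 h2 [_ fpa]] x ax xb.
have n : mesh_negligible a b (fun x y => (fm y * lp y + fp y * lm y) -
    (fm x * lp x + fp x * lm x)).
  apply: eq_mesh_negligible (mesh_negligibleD (mesh_negligibleD h1 h2)
    (mesh_negligibleD
      (mesh_negligible_vanishing (vanishing_continuous cfm) dlp)
      (mesh_negligible_vanishing (vanishing_continuous cfp) dlm))).
  by move=> u v _ _ _; ring.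
have := mesh_negligible_cst n; move=> /(_ x a) ->; rewrite ?in_itv/= ?ax ?lexx//.
by rewrite fpa mul1r.
Qed.

Lemma luckock_solution_fm fm fp : luckock_solution lm lp a b fm fp ->
  forall x, a <= x -> x <= b ->
    fm x = lm x * ((lm b)^-1 - (fm a * lp a + lm a) * (G b - G x)).
Proof.
move=> sol; have cons := luckock_solution_conserved sol.
have /luckock_solutionP [[cfm cfp] _ h1 h2 [fmb _]] := sol.
set K := fm a * lp a + lm a in cons *.
(* By conservation, the second equation multiplied by [(lm y)^-1 * (lp x)^-1] is exactly d(fm / lm)
   minus [K / lp x] times the increment of 1/lm; [negG] turns the latter into [K] dG. *)
have n : mesh_negligible a b (fun x y => (fm y / lm y - K * G y) -
    (fm x / lm x - K * G x)).
  apply: eq_mesh_negligible (mesh_negligibleD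
    (mesh_negligibleM (bounded_onM (bounded_onr leab cvlm) (bounded_onl leab cvlp)) h2)
    (mesh_negligibleM (bounded_on_cst a b (- K)) negG)).
  move=> u v au uv vb.
  have Ku := cons u au (le_trans uv vb).
  have lmu := lm0 au (le_trans uv vb); have lpu := lp0 au (le_trans uv vb).
  have lmv := lm0 (le_trans au uv) vb.
  by rewrite -Ku; field; rewrite ?gt_eqF.
move=> x ax xb; have lmx := lm0 ax xb; have lmb := lm0 leab (lexx b).
have := mesh_negligible_cst n; move=> /(_ x b); rewrite !in_itv/= ax xb leab lexx.
move=> /(_ erefl erefl); rewrite fmb => h.
have -> : fm x = lm x * (fm x / lm x) by field; rewrite gt_eqF.
by congr (_ * _); lra.
Qed.

(** The formula for [fm] involves only the unknown [fm a]. At [x = a] it is a linear equation for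
    [fm a] with leading coefficient [1 + lm a * lp a * (G b - G a)], which is positive; conservation
    then gives [fp]. *)
Lemma luckock_solution_unique fm fp gm gp :
  luckock_solution lm lp a b fm fp -> luckock_solution lm lp a b gm gp ->
  forall x, x \in `[a, b] -> gm x = fm x /\ gp x = fp x.
Proof.
move=> sf sg; have ff := luckock_solution_fm sf; have fg := luckock_solution_fm sg.
have cf := luckock_solution_conserved sf; have cg := luckock_solution_conserved sg.
have lma := lm0 (lexx a) leab; have lpa := lp0 (lexx a) leab.
have G0 : 0 <= G b - G a.
  have /andP[h _] := sG (lexx a) leab (lexx b); apply: le_trans h.
  apply: mulr_ge0; first by rewrite invr_ge0 ltW// lp0.
  by rewrite subr_ge0; apply: homo_rateV_lm; rewrite ?in_itv/= ?lexx ?leab.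
have e : fm a = gm a.
  have := ff _ (lexx a) leab; have := fg _ (lexx a) leab.
  set H := G b - G a in G0 * => h1 h2.
  have : (fm a - gm a) * (1 + lm a * lp a * H) = 0.
    have E1 : fm a - gm a = - lm a * ((fm a - gm a) * lp a) * H.
      by rewrite {1}h1 {1}h2; ring.
    by rewrite mulrDr mulr1 {1}E1; ring.
  move/eqP; rewrite mulf_eq0 subr_eq0 => /orP[/eqP//|/eqP h].
  have : 0 <= lm a * lp a * H by rewrite !mulr_ge0// ltW.
  lra.
move=> x; rewrite in_itv/= => /andP[ax xb].
have em : gm x = fm x by rewrite ff// fg// e.
split => //; have := cf _ ax xb; have := cg _ ax xb.
rewrite em e => <- /addrI/esym/mulIf; apply.
by rewrite gt_eqF// lm0.
Qed.

(* At a solution with fm a = 0 = fp b, the conserved quantity fm lp + fp lm is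
   the common value of lm a and lp b. *)
Lemma luckock_solution_zero fm fp : luckock_solution lm lp a b fm fp ->
  fm a = 0 -> fp b = 0 -> lm a = lp b /\ G b - G a = (lm a * lm b)^-1.
Proof.
move=> sf fma fpb.
have ff := luckock_solution_fm sf; have cf := luckock_solution_conserved sf.
have lma := lm0 (lexx a) leab; have lmb := lm0 leab (lexx b).
split.
  have := cf _ leab (lexx b); rewrite fma fpb !mul0r add0r addr0.
  by have /luckock_solutionP [_ _ _ _ [-> _]] := sf; rewrite mul1r.
have /eqP := ff _ (lexx a) leab; rewrite fma mul0r add0r eq_sym mulf_eq0 gt_eqF//=.
rewrite subr_eq0 => /eqP h.
by rewrite invfM h mulKf// gt_eqF.
Qed.

Lemma luckock_solution_exists V : 0 < V -> lm a = V -> lp b = V ->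
  G b - G a = (V * lm b)^-1 ->
  exists fm fp, [/\ luckock_solution lm lp a b fm fp, fm a = 0 & fp b = 0].
Proof.
move=> V0 lmaV lpbV Gab.
have lmb := lm0 leab (lexx b).
(* With [fm a = 0] the conserved constant is [V]. Then [luckock_solution_fm] forces [u] to be fm /
   lm, and conservation forces [fp]. *)
pose u x := (lm b)^-1 - V * (G b - G x).
pose fm x := lm x * u x.
pose fp x := (V - fm x * lp x) / lm x.
have dG : dominated a b (fun x y => G y - G x).
  apply: dominated_nondecreasing => x y; rewrite !in_itv/= => /andP[ax xb] /andP[ay yb] xy.
  have /andP[h _] := sG ax xy yb; rewrite -subr_ge0; apply: le_trans h.
  apply: mulr_ge0; first by rewrite invr_ge0 ltW// lp0.
  by rewrite subr_ge0; apply: homo_rateV_lm; rewrite ?in_itv/= ?ax ?xb ?ay ?yb.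
(* The upper bound of the sandwich passes the uniform continuity of 1/lm on to [G], as 1/lp is
   bounded. *)
have cG : {within `[a, b], continuous G}.
  apply/within_continuousE => x xab e e0.
  have [K K0 HK] := within_continuous_bounded leab cvlp.
  have eK : 0 < e / (K + 1) by apply: divr_gt0 => //; lra.
  have [d d0 Hd] := within_continuous_unif cvlm eK.
  exists d => // y yab yx.
  suff key s t : s \in `[a, b] -> t \in `[a, b] -> s <= t -> `|t - s| < d -> `|G t - G s| < e.
    case: (leP x y) => [|/ltW] xy; first exact: key.
    by rewrite distrC; apply: key => //; rewrite distrC.
  move=> sab tab st std; have := Hd s t sab tab std.
  move: (sab) (tab); rewrite !in_itv/= => /andP[as_ sb] /andP[at_ tb] h.
  have /andP[h1 h2] := sG as_ st tb.
  have D0 : 0 <= (lm t)^-1 - (lm s)^-1 by rewrite subr_ge0; exact: homo_rateV_lm.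
  rewrite ger0_norm// in h.
  have ps : 0 < (lp s)^-1 by rewrite invr_gt0 lp0.
  have pt : 0 < (lp t)^-1 by rewrite invr_gt0 lp0.
  have psK := HK s as_ sb; rewrite gtr0_norm// in psK.
  rewrite ger0_norm; last by apply: le_trans h1; rewrite mulr_ge0// ltW.
  apply: (le_lt_trans h2); apply: (le_lt_trans (ler_pM (ltW ps) D0 psK h)).
  by rewrite mulrCA gtr_pMr// ltr_pdivrMr; lra.
have cu : {within `[a, b], continuous u}.
  move=> x; apply: cvgB; first exact: cvg_cst.
  apply: cvgM; first exact: cvg_cst.
  by apply: cvgB; [exact: cvg_cst|exact: cG].
have cfm : {within `[a, b], continuous fm}.
  by move=> x; apply: cvgM; [exact: clm|exact: cu].
have cfp : {within `[a, b], continuous fp}.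
  move=> x; apply: cvgM; last exact: cvlm.
  apply: cvgB; first exact: cvg_cst.
  by apply: cvgM; [exact: cfm|exact: clp].
have pos x y : a <= x -> x <= y -> y <= b ->
    [/\ 0 < lm x, 0 < lp x, 0 < lm y & 0 < lp y].
  by move=> ax xy yb; split; [apply: lm0|apply: lp0|apply: lm0|apply: lp0] => //;
    [exact: le_trans yb|exact: le_trans yb|exact: le_trans xy|exact: le_trans xy].
have dfm : dominated a b (fun x y => fm y - fm x).
  apply: eq_dominated (dominatedD (dominatedM (bounded_onl leab cu) dlm)
    (dominatedM (bounded_onM (bounded_on_cst a b V) (bounded_onr leab clm)) dG)).
  by move=> x y ax xy yb; rewrite /fm /u; ring.
have dfp : dominated a b (fun x y => fp y - fp x).
  apply: eq_dominated (dominatedD (dominatedD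
     (dominatedM (bounded_onN (bounded_onM (bounded_onr leab cvlm) (bounded_onl leab cfp))) dlm)
     (dominatedM (bounded_onN (bounded_onM (bounded_onr leab cvlm) (bounded_onl leab cfm))) dlp))
     (dominatedM (bounded_onN (bounded_onM (bounded_onr leab cvlm) (bounded_onr leab clp))) dfm)).
  move=> x y ax xy yb; have [h1 h2 h3 h4] := pos x y ax xy yb; rewrite /fp.
  by field; rewrite !gt_eqF.
(* Exact expansion: [V * lp x * lm x] times the error in [negG], plus the second-order terms
   [V * lp x] dlm dG and [V / (lm x * lm y)] times the square of dlm. *)
have n2 : mesh_negligible a b (fun x y => fp x * (lm y - lm x) + lp x * (fm y - fm x)).
  apply: eq_mesh_negligible (mesh_negligibleD (mesh_negligibleD
    (mesh_negligibleM (bounded_onM (bounded_onM (bounded_on_cst a b V)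
       (bounded_onl leab clp)) (bounded_onl leab clm)) negG)
    (mesh_negligibleM (bounded_onM (bounded_on_cst a b V) (bounded_onl leab clp))
       (mesh_negligible_vanishing (vanishing_continuous clm) dG)))
    (mesh_negligibleM (bounded_onM (bounded_on_cst a b V)
       (bounded_onM (bounded_onl leab cvlm) (bounded_onr leab cvlm)))
       (mesh_negligible_vanishing (vanishing_continuous clm) dlm))).
  move=> x y ax xy yb; have [h1 h2 h3 h4] := pos x y ax xy yb; rewrite /fp /fm /u.
  by field; rewrite !gt_eqF.
(* Since [fm x * lp x + fp x * lm x = V] by construction, the product rule makes this the opposite
   of [n2] up to second-order terms. *)
have n1 : mesh_negligible a b (fun x y => fm x * (lp y - lp x) + lm x * (fp y - fp x)).
  apply: eq_mesh_negligible (mesh_negligibleM (bounded_on_cst a b (-1)) (mesh_negligibleD n2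
    (mesh_negligibleD
      (mesh_negligible_vanishing (vanishing_continuous cfm) dlp)
      (mesh_negligible_vanishing (vanishing_continuous cfp) dlm)))).
  move=> x y ax xy yb; have [h1 h2 h3 h4] := pos x y ax xy yb; rewrite /fp.
  by field; rewrite !gt_eqF.
have fma : fm a = 0.
  by rewrite /fm /u Gab lmaV; field; rewrite !gt_eqF.
have fmb : fm b = 1 by rewrite /fm /u subrr mulr0 subr0 divff// gt_eqF.
exists fm, fp; split => //; last by rewrite /fp fmb lpbV mul1r subrr mul0r.
apply/luckock_solutionP; split => //.
- by split; exact: dominated_bounded_variation.
- by split => //; rewrite /fp fma lmaV mul0r subr0 divff// gt_eqF.
Qed.

End luckock_on_interval.

(** * Level points of monotone functions on an extended interval *)

Section ereal_levels.
Context {R : realType}.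
Implicit Types (s t : \bar R) (U : set (\bar R)).

Lemma ereal_nbhs_left s t U : (s < t)%E -> nbhs t U ->
  exists y, [/\ (s <= y)%E, (y < t)%E & U y].
Proof.
case: t => [r| |]; last by rewrite ltNge leNye.
- move=> sr [d /= d0 dU].
  have near_r (y : R) : r - d < y -> y < r -> U y%:E.
    by move=> h1 h2; apply: dU; rewrite /= ger0_norm; lra.
  case: s sr => [s| |] //.
  + rewrite lte_fin => sr.
    exists (Num.max s (r - d / 2))%:E; rewrite lee_fin lte_fin le_max lexx gt_max sr/=; split => //.
      lra.
    by apply: near_r; rewrite ?lt_max ?gt_max; [apply/orP; right|rewrite sr/=]; lra.
  + move=> _; exists (r - d / 2)%:E; rewrite leNye lte_fin; split => //; first lra.
    by apply: near_r; lra.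
- move=> sy [M [_ MU]].
  case: s sy => [s| |] //.
  + move=> _; exists (Num.max s (M + 1))%:E; rewrite ltry lee_fin le_max lexx; split => //.
    by apply: MU; rewrite lte_fin lt_max; apply/orP; right; lra.
  + move=> _; exists (M + 1)%:E; rewrite leNye ltry; split => //.
    by apply: MU; rewrite lte_fin; lra.
Qed.

Lemma ereal_nbhs_right s t U : (t < s)%E -> nbhs t U ->
  exists y, [/\ (t < y)%E, (y <= s)%E & U y].
Proof.
move=> ts tU; have ts' : (- s < - t)%E by rewrite lteN2.
have tU' : nbhs (- t)%E (-%E @^-1` U).
  have := @oppe_continuous R (- t)%E; rewrite /continuous_at oppeK.
  exact.
have [y [sy yt Uy]] := ereal_nbhs_left ts' tU'.
by exists (- y)%E; split => //; [rewrite lteNr|rewrite leeNl].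
Qed.

Variables (Im Ip : \bar R).
Hypothesis ImIp : (Im < Ip)%E.

Lemma within_continuous_nbhs (g : \bar R -> R) (e : R) s :
  {within `[Im, Ip], continuous g} -> s \in `[Im, Ip] -> 0 < e ->
  exists2 U, nbhs s U & forall x, U x -> x \in `[Im, Ip] -> `|g x - g s| < e.
Proof.
move=> /subspace_continuousP cg sI e0.
have /cvgrPdist_lt /(_ _ e0) := cg s sI.
rewrite /within/= => sU; eexists; first exact: sU.
by move=> x /= Ux xI; rewrite distrC; exact: Ux.
Qed.

(** An intermediate value theorem that names its point. If [g s > c], continuity yields points right
    of [s] still in the set; if [g s < c], some point left of [s] is already an upper bound. The
    cases [s = Ip] and [s = Im] are excluded by the bounds on [c]. *)
Lemma ereal_sup_level (g : \bar R -> R) (c : R) :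
  {within `[Im, Ip], continuous g} ->
  {in `[Im, Ip] &, forall x y, (x <= y)%E -> g y <= g x} ->
  g Ip <= c -> c <= g Im ->
  let s := ereal_sup [set x | x \in `[Im, Ip] /\ c <= g x] in
  s \in `[Im, Ip] /\ g s = c.
Proof.
move=> cg nig gIp gIm s.
have ImI : Im \in `[Im, Ip] by rewrite in_itv/= lexx ltW.
have IpI : Ip \in `[Im, Ip] by rewrite in_itv/= lexx ltW.
have sI : s \in `[Im, Ip].
  rewrite in_itv/=; apply/andP; split.
    by apply: ereal_sup_ubound; split.
  by apply: ge_ereal_sup => x [] /=; rewrite in_itv/= => /andP[].
split => //; apply/eqP; rewrite eq_le; apply/andP; split; rewrite leNgt; apply/negP => gs.
  have sIp : (s < Ip)%E.
    rewrite lt_neqAle; move: sI; rewrite in_itv/= => /andP[_ ->]; rewrite andbT.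
    by apply/eqP => sE; move: gs; rewrite sE ltNge gIp.
  have [|U sU UP] := @within_continuous_nbhs g (g s - c) s cg sI; first lra.
  have [y [sy yIp Uy]] := ereal_nbhs_right sIp sU.
  have yI : y \in `[Im, Ip].
    by move: sI; rewrite !in_itv/= yIp andbT => /andP[h _]; exact: le_trans (ltW sy).
  have := UP _ Uy yI; rewrite ltr_norml => /andP[h _].
  suff : (y <= s)%E by rewrite leNgt sy.
  by apply: ereal_sup_ubound; split => //; lra.
have Ims : (Im < s)%E.
  rewrite lt_neqAle; move: sI; rewrite in_itv/= => /andP[-> _]; rewrite andbT.
  by apply/eqP => sE; move: gs; rewrite -sE ltNge gIm.
have [|U sU UP] := @within_continuous_nbhs g (c - g s) s cg sI; first lra.
have [y [sy ys Uy]] := ereal_nbhs_left Ims sU.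
have yI : y \in `[Im, Ip].
  by move: sI; rewrite !in_itv/= sy/= => /andP[_]; exact/le_trans/ltW.
have := UP _ Uy yI; rewrite ltr_norml => /andP[_ h].
suff : (s <= y)%E by rewrite leNgt ys.
apply: ge_ereal_sup => x [xI cx]; rewrite leNgt; apply/negP => yx.
by have := nig y x yI xI (ltW yx); lra.
Qed.

Lemma ereal_inf_level (g : \bar R -> R) (c : R) :
  {within `[Im, Ip], continuous g} ->
  {in `[Im, Ip] &, forall x y, (x <= y)%E -> g x <= g y} ->
  g Im <= c -> c <= g Ip ->
  let s := ereal_inf [set x | x \in `[Im, Ip] /\ c <= g x] in
  s \in `[Im, Ip] /\ g s = c.
Proof.
move=> cg ndg gIm gIp s.
have ImI : Im \in `[Im, Ip] by rewrite in_itv/= lexx ltW.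
have IpI : Ip \in `[Im, Ip] by rewrite in_itv/= lexx ltW.
have sI : s \in `[Im, Ip].
  rewrite in_itv/=; apply/andP; split.
    by apply: le_ereal_inf_tmp => x [] /=; rewrite in_itv/= => /andP[].
  by apply: ereal_inf_lbound; split.
split => //; apply/eqP; rewrite eq_le; apply/andP; split; rewrite leNgt; apply/negP => gs.
  have Ims : (Im < s)%E.
    rewrite lt_neqAle; move: sI; rewrite in_itv/= => /andP[-> _]; rewrite andbT.
    by apply/eqP => sE; move: gs; rewrite -sE ltNge gIm.
  have [|U sU UP] := @within_continuous_nbhs g (g s - c) s cg sI; first lra.
  have [y [sy ys Uy]] := ereal_nbhs_left Ims sU.
  have yI : y \in `[Im, Ip].
    by move: sI; rewrite !in_itv/= sy/= => /andP[_]; exact/le_trans/ltW.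
  have := UP _ Uy yI; rewrite ltr_norml => /andP[h _].
  suff : (s <= y)%E by rewrite leNgt ys.
  by apply: ereal_inf_lbound; split => //; lra.
have sIp : (s < Ip)%E.
  rewrite lt_neqAle; move: sI; rewrite in_itv/= => /andP[_ ->]; rewrite andbT.
  by apply/eqP => sE; move: gs; rewrite sE ltNge gIp.
have [|U sU UP] := @within_continuous_nbhs g (c - g s) s cg sI; first lra.
have [y [sy yIp Uy]] := ereal_nbhs_right sIp sU.
have yI : y \in `[Im, Ip].
  by move: sI; rewrite !in_itv/= yIp andbT => /andP[h _]; exact: le_trans (ltW sy).
have := UP _ Uy yI; rewrite ltr_norml => /andP[_ h].
suff : (y <= s)%E by rewrite leNgt sy.
apply: le_ereal_inf_tmp => x [xI cx]; rewrite leNgt; apply/negP => xy.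
by have := ndg x y xI yI (ltW xy); lra.
Qed.

End ereal_levels.

(** * Integration against d(1/W) *)

Section inverse_stieltjes.
Context {R : realType}.
Local Notation mR := (measurableTypeR R).
Implicit Types (v x y V : R).

(** [m] is the positive measure -d(1/W) on levels above [v]. Freezing the distribution function
    below [v] avoids the singularity at 0 and keeps it continuous on the whole line. *)
Lemma inverse_measure v : 0 < v -> exists m : {measure set mR -> \bar R},
  (forall x, m [set x] = 0%E) /\
  (forall x y, v <= x -> x <= y -> m `]x, y]%classic = (x^-1 - y^-1)%:E).
Proof.
move=> v0; pose F t := - (Num.max t v)^-1.
have mx0 t : 0 < Num.max t v by rewrite lt_max v0 orbT.
have ndF : {homo F : x y / x <= y}.
  move=> x y xy; rewrite /F lerN2 lef_pV2 ?posrE//.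
  by rewrite ge_max !le_max xy lexx orbT.
have cF : continuous F.
  move=> x; apply: cvgN; apply: cvgV; first by rewrite gt_eqF.
  by apply: (@continuous_max _ _ id (cst v)); [exact: cvg_id|exact: cvg_cst].
pose H : cumulative R R :=
  HB.pack F (isCumulative.Build R _ R F ndF (right_continuousW cF)).
pose m := lebesgue_stieltjes_measure H.
have moc (x y : R) : x <= y -> m `]x, y]%classic = (F y - F x)%:E.
  move=> xy; transitivity (wlength H `]x, y]%classic).
    by apply: (measurable_mu_extE (wlength H)); exact: is_ocitv.
  exact: wlength_itv_bnd.
exists m; split => [x|x y vx xy]; last first.
  transitivity (F y - F x)%:E; first exact: moc.
  by rewrite /F !max_l ?(le_trans vx)// opprK addrC.
apply/eqP; rewrite eq_le measure_ge0 andbT; apply/lee_addgt0Pr => e e0.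
have /cvgrPdist_lt /(_ _ e0) [d /= d0 xd] := cF x.
rewrite add0e; apply: (@le_trans _ _ (m `]x - d / 2, x]%classic)).
  apply: le_measure; rewrite ?inE; [exact: measurable_set1|exact: measurable_itvR|].
  by move=> y /= ->; rewrite in_itv/= lexx andbT; lra.
rewrite moc; last by lra.
rewrite lee_fin; apply: ltW; apply: le_lt_trans (xd (x - d / 2) _); first exact: ler_norm.
by rewrite /ball_/= opprB addrC subrK ger0_norm; lra.
Qed.

Lemma is_dcharge_dcharge (a b : R) (f : R -> R) nu :
  is_dcharge a b f nu -> is_dcharge a b f (dcharge a b f).
Proof.
move=> h; rewrite /dcharge; case: pselect => [e|[]]; first by case: cid.
by exists nu.
Qed.

(** As 1/W decreases, its charge is the opposite of [m]: for any Hahn decomposition the positive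
    part vanishes and the negative part is [m] on [[v, V]]. *)
Lemma charge_integral_inverse (m : {measure set mR -> \bar R}) v V (h : R -> \bar R) :
  0 < v -> v <= V -> (forall x, m [set x] = 0%E) ->
  (forall x y, v <= x -> x <= y -> m `]x, y]%classic = (x^-1 - y^-1)%:E) ->
  charge_integral (dcharge v V (fun W => W^-1)) `[v, V]%classic h =
    (- \int[m]_(x in `[v, V]) h x)%E.
Proof.
move=> v0 vV m1 moc.
have mvV : measurable (`[v, V]%classic : set mR) by exact: measurable_itvR.
have mfin : (m `[v, V]%classic < +oo)%E.
  have -> : `[v, V]%classic = [set v] `|` `]v, V]%classic.
    by rewrite -(set_itv1 v) -itv_bndbnd_setU ?bnd_simp.
  rewrite measureU//; last by rewrite -subset0 => z /= [->]; rewrite in_itv/= ltxx.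
  have h1 : (m [set v] < +oo)%E by rewrite m1 ltry.
  have h2 : (m `]v, V]%classic < +oo)%E by rewrite moc ?ltry.
  exact: lte_add_pinfty h1 h2.
pose nu' : {charge set mR -> \bar R} :=
  cscale (-1) (charge_of_finite_measure (mfrestr mvV mfin)).
have nu'E A : nu' A = (- m (A `&` `[v, V]%classic))%E.
  transitivity ((-1)%:E * m (A `&` `[v, V]%classic))%E; first by [].
  by rewrite EFinN mulN1e.
have dnu' : is_dcharge v V (fun W => W^-1) nu'.
  split.
  - by move=> A mA; rewrite !nu'E -setIA setIid.
  - move=> x; rewrite nu'E; apply/eqP; rewrite oppe_eq0 eq_le measure_ge0 andbT -(m1 x).
    apply: le_measure; rewrite ?inE; [|exact: measurable_set1|exact: subIsetl].
    by apply: measurableI; [exact: measurable_set1|].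
  - move=> x y vx xy yV; rewrite nu'E setIidl; last exact: ocitv_subset.
    by rewrite moc// -EFinN opprB.
have dnu := is_dcharge_dcharge dnu'.
have nuE A : measurable A -> dcharge v V (fun W => W^-1) A = (- m (A `&` `[v, V]%classic))%E.
  by move=> mA; rewrite (is_dcharge_unique dnu dnu')// nu'E.
rewrite /charge_integral.
set nu := dcharge _ _ _ in dnu nuE *.
set PN := projT2 (cid (projT2 (cid (Hahn_decomposition nu)))).
have jp0 (A : set mR) : measurable A -> jordan_pos PN A = 0%E.
  move=> mA; apply/eqP; rewrite eq_le measure_ge0 andbT.
  have [[mP _] _ _ _] := PN.
  rewrite jordan_posE cjordan_posE /crestr0 mem_set// /crestr nuE.
    by rewrite oppe_le0.
  exact: measurableI.
have jnE (A : set mR) : measurable A -> A `<=` `[v, V]%classic -> jordan_neg PN A = m A.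
  move=> mA Av.
  have : nu A = (jordan_pos PN A + (-1)%:E * jordan_neg PN A)%E := jordan_decomp PN mA.
  by rewrite nuE// setIidl// jp0// add0e EFinN mulN1e => /oppe_inj.
rewrite (eq_measure_integral mzero); last by move=> A mA _; exact: jp0.
rewrite integral_measure_zero sub0e; congr oppe.
exact: eq_measure_integral.
Qed.

(** The superlevel sets of a monotone function are intervals. *)
Lemma nondecreasing_measurable_itv (a b : R) (h : R -> \bar R) :
  {in `[a, b] &, {homo h : x y / x <= y >-> (x <= y)%E}} ->
  measurable_fun `[a, b]%classic h.
Proof.
move=> ndh.
apply: (measurability (@ErealGenOInfty.G R)) => [|/= _ [_] [r] -> <-].
  exact: ErealGenOInfty.measurableE.
apply: is_interval_measurable => s t/=.
rewrite !in_itv/= !andbT => -[sab fs] [tab ft] u /andP[su ut].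
move: (sab) (tab) => /andP[as_ sb] /andP[at_ tb].
have uab : a <= u <= b by rewrite (le_trans as_ su) (le_trans ut tb).
split; first by rewrite in_itv.
by rewrite in_itv/= andbT; apply: (lt_le_trans fs); apply: ndh; rewrite ?in_itv.
Qed.

(** On []x, y]] the density lies between its values at the ends. The bounds are sums, not
    differences, because the integrals may be infinite. *)
Lemma inverse_integral_sandwich (m : {measure set mR -> \bar R}) v Vm (h : R -> \bar R) :
  0 < v -> (forall x, m [set x] = 0%E) ->
  (forall x y, v <= x -> x <= y -> m `]x, y]%classic = (x^-1 - y^-1)%:E) ->
  (forall x, x \in `[v, Vm] -> (0 <= h x)%E) ->
  {in `[v, Vm] &, {homo h : x y / x <= y >-> (x <= y)%E}} ->
  forall x y, v <= x -> x <= y -> y <= Vm ->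
  (\int[m]_(t in `[v, x]) h t + h x * (x^-1 - y^-1)%:E <= \int[m]_(t in `[v, y]) h t)%E /\
  (\int[m]_(t in `[v, y]) h t <= \int[m]_(t in `[v, x]) h t + h y * (x^-1 - y^-1)%:E)%E.
Proof.
move=> v0 m1 moc h0 ndh x y vx xy yV.
have mh := nondecreasing_measurable_itv ndh.
have sub (A : set R) : A `<=` `[v, y]%classic -> A `<=` `[v, Vm]%classic.
  move=> Av z /Av /=; rewrite !in_itv/= => /andP[-> zy]; exact: le_trans yV.
have syx : `]x, y]%classic `<=` `[v, y]%classic by apply: ocitv_subset.
have mxy : measurable (`]x, y]%classic : set mR) by exact: measurable_itvR.
have mhxy : measurable_fun `]x, y]%classic h.
  by apply: measurable_funS mh; [exact: measurable_itvR|exact: sub].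
have h0xy z : `]x, y]%classic z -> (0 <= h z)%E by move=> /(sub _ syx); exact: h0.
have hin z : x <= z -> z <= y -> z \in `[v, Vm].
  by move=> xz zy; rewrite in_itv/= (le_trans vx xz) (le_trans zy yV).
have -> : (\int[m]_(t in `[v, y]) h t =
    \int[m]_(t in `[v, x]) h t + \int[m]_(t in `]x, y]) h t)%E.
  have E : `[v, y]%classic = `[v, x]%classic `|` `]x, y]%classic.
    by rewrite -itv_bndbnd_setU ?bnd_simp.
  rewrite {1}E ge0_integral_setU//.
  - rewrite -E; apply: measurable_funS mh; [exact: measurable_itvR|exact: sub].
  - by rewrite -E => z /(@sub _ (@subset_refl _ _)); exact: h0.
  - apply/disj_setPS => z [] /=; rewrite !in_itv/= => /andP[_ zx] /andP[xz _].
    by move: (lt_le_trans xz zx); rewrite ltxx.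
have mE := moc x y vx xy.
have h0c w : w \in `[v, Vm] -> forall z, `]x, y]%classic z -> (0 <= cst (h w) z)%E.
  by move=> wI z _; exact: h0.
have xI : x \in `[v, Vm] by apply: hin.
have yI : y \in `[v, Vm] by apply: hin.
rewrite -mE -!integral_cst//; split; apply: leeD => //; apply: ge0_le_integral => //.
- exact: h0c.
- by move=> z /=; rewrite in_itv/= => /andP[xz zy]; apply: ndh => //; [exact/hin/zy/ltW|exact: ltW].
- by move=> z /=; rewrite in_itv/= => /andP[xz zy]; apply: ndh => //; exact/hin/zy/ltW.
Qed.

End inverse_stieltjes.

(** * The crossing of the rates, their inverses and Phi *)

Section competitive_window.
Context {R : realType}.
Variables (Im Ip : \bar R) (lm lp : \bar R -> R).
Hypotheses (I_nonempty : (Im < Ip)%E)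
  (lm_ge0 : forall x : \bar R, x \in `[Im, Ip] -> 0 <= lm x)
  (lp_ge0 : forall x : \bar R, x \in `[Im, Ip] -> 0 <= lp x)
  (lm_cont : {within `[Im, Ip], continuous lm})
  (lp_cont : {within `[Im, Ip], continuous lp})
  (lm_noninc : forall x y : \bar R, x \in `[Im, Ip] -> y \in `[Im, Ip] ->
     (x <= y)%E -> lm y <= lm x)
  (lp_nondec : forall x y : \bar R, x \in `[Im, Ip] -> y \in `[Im, Ip] ->
     (x <= y)%E -> lp x <= lp y)
  (lm_gt0 : forall x : R, (Im < x%:E)%E -> (x%:E < Ip)%E -> 0 < lm x%:E)
  (lp_gt0 : forall x : R, (Im < x%:E)%E -> (x%:E < Ip)%E -> 0 < lp x%:E)
  (VW_lt_Vmax : VW Im Ip lm lp < Vmax Im Ip lm lp).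

Local Notation v := (VW Im Ip lm lp).
Local Notation Vm := (Vmax Im Ip lm lp).
Local Notation a_ := (lm_inv Im Ip lm).
Local Notation b_ := (lp_inv Im Ip lp).

Let ImI : Im \in `[Im, Ip]. Proof. by rewrite in_itv/= lexx ltW. Qed.
Let IpI : Ip \in `[Im, Ip]. Proof. by rewrite in_itv/= lexx ltW. Qed.

Let VmP : Vm <= lm Im /\ Vm <= lp Ip.
Proof. by rewrite /Vmax !ge_min !lexx orbT. Qed.

Let VW_ge x : x \in `[Im, Ip] -> Num.min (lm x) (lp x) <= v.
Proof.
move=> xI; apply: ub_le_sup; last by exists x.
exists (lp Ip) => _ [y yI <-]; rewrite ge_min; apply/orP; right.
by apply: lp_nondec => //; move: yI; rewrite /= in_itv/= => /andP[].
Qed.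

(** [lp Ip] is at least [Vm], which exceeds [v], so the minimum of the rates at [Ip] can only be
    [lm Ip]. *)
Let lmIp : lm Ip <= v.
Proof.
have := VW_ge IpI; rewrite ge_min => /orP[//|h].
by have := VmP; move: VW_lt_Vmax h; lra.
Qed.

Let lpIm : lp Im <= v.
Proof.
have := VW_ge ImI; rewrite ge_min => /orP[h|//].
by have := VmP; move: VW_lt_Vmax h; lra.
Qed.

(** A zero of the nonincreasing function [lm x - lp x] is a maximiser of the minimum of the rates.
    The strict inequality between [v] and [Vm] excludes both ends of the interval, so the zero is a
    real number. *)
Lemma lm_lp_crossing : exists w : R,
  [/\ (Im < w%:E)%E, (w%:E < Ip)%E, lm w%:E = v & lp w%:E = v].
Proof.
have cD : {within `[Im, Ip], continuous (fun x => lm x - lp x)}.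
  by move=> x; apply: cvgB; [exact: lm_cont|exact: lp_cont].
have niD : {in `[Im, Ip] &, forall x y, (x <= y)%E -> lm y - lp y <= lm x - lp x}.
  by move=> x y xI yI xy; have := lm_noninc xI yI xy; have := lp_nondec xI yI xy; lra.
have DIp : lm Ip - lp Ip <= 0 by move: VmP lmIp VW_lt_Vmax; lra.
have DIm : 0 <= lm Im - lp Im by move: VmP lpIm VW_lt_Vmax; lra.
have [] := ereal_sup_level I_nonempty cD niD DIp DIm.
move: (ereal_sup _) => w wI /eqP; rewrite subr_eq0 => /eqP lmlp.
have lmw : lm w = v.
  apply/eqP; rewrite eq_le; have := VW_ge wI; rewrite -lmlp minxx => ->/=.
  apply: ge_sup; first by exists (Num.min (lm Im) (lp Im)), Im.
  move=> _ [x xI <-]; rewrite ge_min; case: (leP x w) => xw.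
    by rewrite lmlp lp_nondec ?orbT.
  by rewrite (lm_noninc wI xI (ltW xw)).
have Imw : (Im < w)%E.
  rewrite lt_neqAle; move: (wI); rewrite in_itv/= => /andP[-> _]; rewrite andbT.
  by apply/eqP => /(congr1 lm) e; move: VmP VW_lt_Vmax; lra.
have wIp : (w < Ip)%E.
  rewrite lt_neqAle; move: (wI); rewrite in_itv/= => /andP[_ ->]; rewrite andbT.
  by apply/eqP => /(congr1 lp) e; move: VmP VW_lt_Vmax; lra.
case: w wI lmlp lmw Imw wIp => [w| |] wI lmlp lmw Imw wIp; last by rewrite ltNge leNye in Imw.
- by exists w; split => //; rewrite -lmlp.
- by rewrite ltNge leey in wIp.
Qed.

Lemma VW_gt0 : 0 < v.
Proof. by have [w [h1 h2 <- _]] := lm_lp_crossing; exact: lm_gt0. Qed.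

Lemma lm_inv_level V : v <= V -> V <= Vm -> a_ V \in `[Im, Ip] /\ lm (a_ V) = V.
Proof.
move=> vV VVm; apply: ereal_sup_level => //; first exact: le_trans vV.
by have [h _] := VmP; exact: le_trans h.
Qed.

Lemma lp_inv_level V : v <= V -> V <= Vm -> b_ V \in `[Im, Ip] /\ lp (b_ V) = V.
Proof.
move=> vV VVm; apply: ereal_inf_level => //; first exact: le_trans vV.
by have [_ h] := VmP; exact: le_trans h.
Qed.

Lemma lm_inv_noninc V V' : V <= V' -> (a_ V' <= a_ V)%E.
Proof. by move=> VV'; apply: ereal_sup_le => x /= [xI h]; split => //; exact: le_trans h. Qed.

Lemma lp_inv_nondec V V' : V <= V' -> (b_ V <= b_ V')%E.
Proof. by move=> VV'; apply: le_ereal_inf => x /= [xI h]; split => //; exact: le_trans h. Qed.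

Lemma lm_inv_lt V (w : \bar R) : v < V -> V <= Vm -> w \in `[Im, Ip] -> lm w = v -> (a_ V < w)%E.
Proof.
move=> vV VVm wI lmw; have [aI lma] := lm_inv_level (ltW vV) VVm.
rewrite ltNge; apply/negP => wa; have := lm_noninc wI aI wa.
by move: vV; rewrite lma lmw; lra.
Qed.

Lemma lp_inv_gt V (w : \bar R) : v < V -> V <= Vm -> w \in `[Im, Ip] -> lp w = v -> (w < b_ V)%E.
Proof.
move=> vV VVm wI lpw; have [bI lpb] := lp_inv_level (ltW vV) VVm.
rewrite ltNge; apply/negP => bw; have := lp_nondec bI wI bw.
by move: vV; rewrite lpb lpw; lra.
Qed.

Definition Phi_density (W : R) : \bar R :=
  (((lp (a_ W))%:E)^-1 + ((lm (b_ W))%:E)^-1)%E.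
Local Notation h := Phi_density.

Lemma le_inve_EFin (x y : R) : 0 <= x -> x <= y -> ((y%:E)^-1 <= (x%:E)^-1)%E.
Proof.
move=> x0 xy; rewrite !inver; case: (eqVneq x 0) => [_|xn]; first exact: leey.
have x0' : 0 < x by rewrite lt_neqAle eq_sym xn.
have y0 : 0 < y := lt_le_trans x0' xy.
by rewrite gt_eqF// lee_fin lef_pV2.
Qed.

Lemma Phi_density_nondec :
  {in `[v, Vm] &, {homo h : x y / x <= y >-> (x <= y)%E}}.
Proof.
move=> x y; rewrite !in_itv/= => /andP[vx xV] /andP[vy yV] xy.
have [ax _] := lm_inv_level vx xV; have [ay _] := lm_inv_level vy yV.
have [bx _] := lp_inv_level vx xV; have [by_ _] := lp_inv_level vy yV.
apply: leeD; apply: le_inve_EFin; [exact: lp_ge0| |exact: lm_ge0|].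
  by apply: lp_nondec => //; exact: lm_inv_noninc.
by apply: lm_noninc => //; exact: lp_inv_nondec.
Qed.

Lemma Phi_density_gt0 x : x \in `[v, Vm] -> (0 < h x)%E.
Proof.
rewrite in_itv/= => /andP[vx xV].
have [ax _] := lm_inv_level vx xV; have [bx _] := lp_inv_level vx xV.
have pos (r : R) : 0 <= r -> (0 < (r%:E)^-1)%E.
  move=> r0; rewrite inver; case: eqVneq => [_|rn]; first exact: lt0y.
  by rewrite lte_fin invr_gt0 lt_neqAle eq_sym rn.
by apply: adde_gt0; apply: pos; [exact: lp_ge0|exact: lm_ge0].
Qed.

Local Notation Phi := (Phi Im Ip lm lp).

(** The integral defining [Phi] is opened only here; everything later rests on these bounds. *)
Lemma Phi_sandwich : Phi v = 0%E /\ forall x y, v <= x -> x <= y -> y <= Vm ->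
  (Phi x + h x * (x^-1 - y^-1)%:E <= Phi y)%E /\
  (Phi y <= Phi x + h y * (x^-1 - y^-1)%:E)%E.
Proof.
have [m [m1 moc]] := inverse_measure VW_gt0.
have PhiE V : v <= V -> Phi V = (\int[m]_(t in `[v, V]) h t)%E.
  by move=> vV; rewrite /Defs.Phi (charge_integral_inverse _ VW_gt0 vV m1 moc) oppeK.
split.
  rewrite PhiE// set_itv1; apply: null_set_integral => //.
  exact: measurable_fun_set1.
move=> x y vx xy yV; rewrite !PhiE//; last exact: le_trans xy.
apply: (@inverse_integral_sandwich _ m v Vm) => //.
- exact: VW_gt0.
- by move=> z zI; apply/ltW/Phi_density_gt0.
- exact: Phi_density_nondec.
Qed.

Lemma Phi_ge0 V : v <= V -> V <= Vm -> (0 <= Phi V)%E.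
Proof.
move=> vV VVm; have [P0 PS] := Phi_sandwich.
have [H _] := PS _ _ (lexx v) vV VVm; apply: le_trans H.
rewrite P0 add0e mule_ge0//.
  by apply/ltW/Phi_density_gt0; rewrite in_itv/= lexx ltW.
rewrite lee_fin subr_ge0 lef_pV2 ?posrE//; last exact: VW_gt0.
exact: lt_le_trans VW_gt0 vV.
Qed.

Lemma lm_inv_real V : v < V -> V < Vm -> exists a : R,
  [/\ a_ V = a%:E, (Im < a%:E)%E & lm a%:E = V].
Proof.
move=> vV VVm; have [aI lma] := lm_inv_level (ltW vV) (ltW VVm).
have [w [Imw wIp lmw _]] := lm_lp_crossing.
have wI : w%:E \in `[Im, Ip] by rewrite in_itv/= !ltW.
have aw := lm_inv_lt vV (ltW VVm) wI lmw.
have Ima : (Im < a_ V)%E.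
  rewrite lt_neqAle; move: (aI); rewrite in_itv/= => /andP[-> _]; rewrite andbT.
  by apply/eqP => /(congr1 lm) e; move: VmP VVm; lra.
case: (a_ V) aI lma aw Ima => [a| |] aI lma aw Ima; last by rewrite ltNge leNye in Ima.
- by exists a.
- by rewrite ltNge leey in aw.
Qed.

Lemma lp_inv_real V : v < V -> V < Vm -> exists b : R,
  [/\ b_ V = b%:E, (b%:E < Ip)%E & lp b%:E = V].
Proof.
move=> vV VVm; have [bI lpb] := lp_inv_level (ltW vV) (ltW VVm).
have [w [Imw wIp _ lpw]] := lm_lp_crossing.
have wI : w%:E \in `[Im, Ip] by rewrite in_itv/= !ltW.
have wb := lp_inv_gt vV (ltW VVm) wI lpw.
have bIp : (b_ V < Ip)%E.
  rewrite lt_neqAle; move: (bI); rewrite in_itv/= => /andP[_ ->]; rewrite andbT.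
  by apply/eqP => /(congr1 lp) e; move: VmP VVm; lra.
case: (b_ V) bI lpb wb bIp => [b| |] bI lpb wb bIp; last by rewrite ltNge leNye in wb.
- by exists b.
- by rewrite ltNge leey in bIp.
Qed.

Lemma inv_lt V (a b : R) : v < V -> V <= Vm -> a_ V = a%:E -> b_ V = b%:E -> a < b.
Proof.
move=> vV VVm aV bV; have [w [Imw wIp lmw lpw]] := lm_lp_crossing.
have wI : w%:E \in `[Im, Ip] by rewrite in_itv/= !ltW.
rewrite -lte_fin -aV -bV; apply: (@lt_trans _ _ w%:E); first exact: lm_inv_lt.
exact: lp_inv_gt.
Qed.

Lemma Phi_density_EFin V (a b : R) : a_ V = a%:E -> b_ V = b%:E ->
  0 < lp a%:E -> 0 < lm b%:E -> h V = ((lp a%:E)^-1 + (lm b%:E)^-1)%:E.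
Proof. by move=> aV bV lpa lmb; rewrite /Phi_density aV bV !inver !gt_eqF. Qed.

(** * The value of Phi at the level of a window *)

Section on_subinterval.
Variables (a b : R).
Hypotheses (Ima : (Im < a%:E)%E) (bIp : (b%:E < Ip)%E).

Lemma subinterval_in x : a <= x -> x <= b -> (Im < x%:E)%E /\ (x%:E < Ip)%E.
Proof. by move=> ax xb; split; [exact: lt_le_trans Ima _|exact: le_lt_trans bIp]. Qed.

Lemma subinterval_itv x : x \in `[a, b] -> x%:E \in `[Im, Ip].
Proof.
by rewrite !in_itv/= => /andP[ax xb]; have [? ?] := subinterval_in ax xb; rewrite !ltW.
Qed.

Lemma subinterval_gt0 x : a <= x -> x <= b -> 0 < lm x%:E /\ 0 < lp x%:E.
Proof. by move=> ax xb; have [? ?] := subinterval_in ax xb; rewrite lm_gt0// lp_gt0. Qed.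

Lemma subinterval_continuous (g : \bar R -> R) : {within `[Im, Ip], continuous g} ->
  {within `[a, b], continuous (g \o EFin)}.
Proof.
move=> cg; apply/within_continuousE => x xab e e0.
have [U xU UP] := within_continuous_nbhs cg (subinterval_itv xab) e0.
case: xU => d /= d0 dU; exists d => // y yab yx.
by apply: UP; [apply: dU; rewrite /= distrC|exact: subinterval_itv].
Qed.

Lemma subinterval_noninc : {in `[a, b] &, {homo lm \o EFin : x y / x <= y >-> y <= x}}.
Proof. by move=> x y xab yab xy; apply: lm_noninc; rewrite ?subinterval_itv. Qed.

Lemma subinterval_nondec : {in `[a, b] &, {homo lp \o EFin : x y / x <= y}}.
Proof. by move=> x y xab yab xy; apply: lp_nondec; rewrite ?subinterval_itv. Qed.

(* Changing variables W = lm x left of the crossing point w and W = lp x right of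
   it turns the two terms of Phi into integrals over [a, w] and [w, b]; the second
   is integrated by parts, i.e. G2 = G - 1 / (lm lp). *)
Lemma Phi_formula V (G : R -> R) : v < V -> V <= Vm ->
  a_ V = a%:E -> b_ V = b%:E ->
  stieltjes_sandwich a b (fun x => (lp x%:E)^-1) (fun x => (lm x%:E)^-1) G ->
  Phi V = (G b - G a - (V * lm b%:E)^-1 + v ^- 2)%:E.
Proof.
move=> vV VVm aV bV sG; have v0 := VW_gt0.
have [w [Imw wIp lmw lpw]] := lm_lp_crossing.
have wI : w%:E \in `[Im, Ip] by rewrite in_itv/= !ltW.
have [P0 PS] := Phi_sandwich.
have levels W : v < W -> W <= V -> exists s t, [/\ a_ W = s%:E, b_ W = t%:E,
    a <= s <= w, w <= t <= b & lm s%:E = W /\ lp t%:E = W].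
  move=> vW WV; have WVm := le_trans WV VVm.
  have [aI lma] := lm_inv_level (ltW vW) WVm.
  have [bI lpb] := lp_inv_level (ltW vW) WVm.
  have aw := lm_inv_lt vW WVm wI lmw.
  have wb := lp_inv_gt vW WVm wI lpw.
  have := lm_inv_noninc WV; have := lp_inv_nondec WV; rewrite aV bV.
  case: (a_ W) aI lma aw => [s| |] // aI lma aw; case: (b_ W) bI lpb wb => [t| |] // bI lpb wb.
  rewrite !lee_fin => tb as_; exists s, t; split => //.
    by rewrite as_ -lee_fin ltW.
  by rewrite tb andbT -lee_fin ltW.
have [s0 [t0 [sE tE /andP[_ aw] /andP[wb _] [lma lpb]]]] := levels V vV (lexx V).
have {sE} es : s0 = a by apply: EFin_inj; rewrite -sE.
have {tE} et : t0 = b by apply: EFin_inj; rewrite -tE.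
rewrite es in aw lma; rewrite et in wb lpb; clear es et s0 t0.
have ab := le_trans aw wb.
pose p x := (lp x%:E)^-1; pose q x := (lm x%:E)^-1.
have p0 x : a <= x -> x <= b -> 0 < p x.
  by move=> ax xb; rewrite invr_gt0; have [] := subinterval_gt0 ax xb.
have q0 x : a <= x -> x <= b -> 0 < q x.
  by move=> ax xb; rewrite invr_gt0; have [] := subinterval_gt0 ax xb.
(* [G2] is a primitive of -q dp, so it is enclosed between multiples of the decrease of [p]. *)
pose G2 x := G x - p x * q x.
have sG2 x y : a <= x -> x <= y -> y <= b ->
    q x * (p x - p y) <= G2 y - G2 x <= q y * (p x - p y).
  move=> ax xy yb; have /andP[h1 h2] := sG x y ax xy yb.
  rewrite /= -!/(p _) -!/(q _) in h1 h2.
  by rewrite /G2; apply/andP; split; lra.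
(* At level [v] the inverses may be the far ends of plateaus through [w]; choosing [w] instead makes
   both paths start at the crossing point. *)
pose al W := if W <= v then w else fine (a_ W).
pose be W := if W <= v then w else fine (b_ W).
have alP W : v <= W -> W <= V -> [/\ a <= al W, al W <= w & lm (al W)%:E = W].
  move=> vW WV; rewrite /al; case: (ltP v W) => [vW'|Wv].
    by have [s [t [-> _ /andP[? ?] _ []]]] := levels W vW' WV.
  by split => //; rewrite lmw; apply/eqP; rewrite eq_le vW.
have beP W : v <= W -> W <= V -> [/\ w <= be W, be W <= b & lp (be W)%:E = W].
  move=> vW WV; rewrite /be; case: (ltP v W) => [vW'|Wv].
    by have [s [t [_ -> _ /andP[? ?] []]]] := levels W vW' WV.
  by split => //; rewrite lpw; apply/eqP; rewrite eq_le vW.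
have al_mono x y : v <= x -> x <= y -> y <= V -> al y <= al x.
  move=> vx xy yV; rewrite /al; case: (ltP v x) => [vx'|xv].
    have vy' := lt_le_trans vx' xy; rewrite /= (lt_geF vy').
    have [s [t [ex _ _ _ _]]] := levels x vx' (le_trans xy yV).
    have [s' [t' [ey _ _ _ _]]] := levels y vy' yV.
    by have := lm_inv_noninc xy; rewrite ex ey lee_fin.
  case: (ltP v y) => // vy; have [s' [t' [ey _ /andP[_ ?] _ _]]] := levels y vy yV.
  by rewrite ey.
have be_mono x y : v <= x -> x <= y -> y <= V -> be x <= be y.
  move=> vx xy yV; rewrite /be; case: (ltP v x) => [vx'|xv].
    have vy' := lt_le_trans vx' xy; rewrite /= (lt_geF vy').
    have [s [t [_ ex _ _ _]]] := levels x vx' (le_trans xy yV).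
    have [s' [t' [_ ey _ _ _]]] := levels y vy' yV.
    by have := lp_inv_nondec xy; rewrite ex ey lee_fin.
  case: (ltP v y) => // vy; have [s' [t' [_ ey _ /andP[? _] _]]] := levels y vy yV.
  by rewrite ey.
have pq_gt0 W : v <= W -> W <= V -> 0 < p (al W) /\ 0 < q (be W).
  move=> vW WV; have [a1 a2 _] := alP W vW WV; have [b1 b2 _] := beP W vW WV.
  by split; [exact/p0/(le_trans a2)|apply: q0 => //; exact: le_trans b1].
have hE W : v < W -> W <= V -> h W = (p (al W) + q (be W))%:E.
  move=> vW WV; have [s [t [ea eb /andP[as_ sw] /andP[wt tb] _]]] := levels W vW WV.
  have [_ h1] := subinterval_gt0 as_ (le_trans sw wb).
  have [h2 _] := subinterval_gt0 (le_trans aw wt) tb.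
  by rewrite (Phi_density_EFin ea eb h1 h2) /p /q /al /be (lt_geF vW) ea eb.
(* Only an inequality holds at [v], since [a_ v] may lie right of [w] and [b_ v] left of it. *)
have hv : (h v <= (p (al v) + q (be v))%:E)%E.
  have vVm := ltW VW_lt_Vmax.
  have [aI _] := lm_inv_level (lexx v) vVm; have [bI _] := lp_inv_level (lexx v) vVm.
  have lpw0 : 0 < lp w%:E by rewrite lpw.
  have lmw0 : 0 < lm w%:E by rewrite lmw.
  have wa : (w%:E <= a_ v)%E by apply: ereal_sup_ubound; rewrite /= lmw.
  have bw : (b_ v <= w%:E)%E by apply: ereal_inf_lbound; rewrite /= lpw.
  have -> : ((p (al v) + q (be v))%:E = ((lp w%:E)%:E)^-1 + ((lm w%:E)%:E)^-1)%E.
    by rewrite !inver !gt_eqF// /p /q /al /be lexx.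
  apply: leeD; apply: le_inve_EFin; rewrite ?(ltW lpw0) ?(ltW lmw0)//.
    exact: lp_nondec.
  exact: lm_noninc.
have vVm := ltW VW_lt_Vmax.
have vVle := ltW vV.
have hle W : v <= W -> W <= V -> (h W <= (p (al W) + q (be W))%:E)%E.
  by rewrite le_eqVlt => /predU1P[<- //|vW WV]; rewrite hE.
have hin W : v <= W -> W <= V -> W \in `[v, Vm].
  by move=> vW WV; rewrite in_itv/= vW (le_trans WV).
have hfin W : v <= W -> W <= V -> h W = (fine (h W))%:E.
  move=> vW WV; rewrite fineK// ge0_fin_numE; last exact/ltW/Phi_density_gt0/hin.
  by apply: le_lt_trans (hle W vW WV) _; rewrite ltry.
pose hr W := fine (h W).
have hr_le W : v <= W -> W <= V -> hr W <= p (al W) + q (be W).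
  by move=> vW WV; have := hle W vW WV; rewrite hfin// lee_fin.
have hr_eq W : v < W -> W <= V -> hr W = p (al W) + q (be W).
  by move=> vW WV; rewrite /hr hE.
have V0 : 0 < V := lt_trans v0 vV.
have dF x y : v <= x -> x <= y -> 0 <= x^-1 - y^-1.
  move=> vx xy; rewrite subr_ge0 lef_pV2 ?posrE//; last exact: lt_le_trans v0 vx.
  exact: lt_le_trans v0 (le_trans vx xy).
have fP W : v <= W -> W <= V -> Phi W = (fine (Phi W))%:E.
  move=> vW WV; have WVm := le_trans WV VVm.
  rewrite fineK// ge0_fin_numE; last exact: Phi_ge0.
  have [_] := PS _ _ (lexx v) vW WVm.
  by rewrite P0 add0e hfin// -EFinM => /le_lt_trans; apply; rewrite ltry.
(* The candidate for [Phi W]: p dq over [[al W, w]] plus -q dp over [[w, be W]]. As [q (al W)] and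
   [p (be W)] both equal [W^-1], its increments are governed by those of -1/W. *)
pose Q W := (G w - G (al W)) + (G2 (be W) - G2 w).
have ndhr : {in `[v, V] &, {homo hr : x y / x <= y}}.
  move=> x y; rewrite !in_itv/= => /andP[vx xV] /andP[vy yV] xy.
  by have := Phi_density_nondec (hin x vx xV) (hin y vy yV) xy; rewrite hfin// (hfin y)// lee_fin.
have cF : {within `[v, V], continuous (fun W : R => - W^-1)}.
  apply/subspace_continuousP => x; rewrite /= in_itv/= => /andP[vx xV].
  apply: cvgN; apply: cvgV; first by rewrite gt_eqF// (lt_le_trans v0).
  by apply: cvg_within_filter; exact: cvg_id.
have sP x y : v <= x -> x <= y -> y <= V ->
    hr x * (- y^-1 - - x^-1) <= fine (Phi y) - fine (Phi x) <= hr y * (- y^-1 - - x^-1).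
  move=> vx xy yV; have yVm := le_trans yV VVm; have xV := le_trans xy yV.
  have vy := le_trans vx xy.
  have := PS x y vx xy yVm.
  rewrite (fP x)// (fP y)// (hfin x)// (hfin y)// -!EFinM -!EFinD !lee_fin -!/(hr _).
  by move=> [h1 h2]; apply/andP; split; lra.
have sQ x y : v <= x -> x <= y -> y <= V ->
    hr x * (- y^-1 - - x^-1) <= Q y - Q x <= hr y * (- y^-1 - - x^-1).
  move=> vx xy yV; have xV := le_trans xy yV; have vy := le_trans vx xy.
  have [ax1 ax2 ax3] := alP x vx xV; have [bx1 bx2 bx3] := beP x vx xV.
  have [ay1 ay2 ay3] := alP y vy yV; have [by1 by2 by3] := beP y vy yV.
  have /andP[g1 g2] := sG _ _ ay1 (al_mono _ _ vx xy yV) (le_trans ax2 wb).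
  have /andP[g3 g4] := sG2 _ _ (le_trans aw bx1) (be_mono _ _ vx xy yV) by2.
  rewrite /= ay3 ax3 -!/(p _) in g1 g2; rewrite /p bx3 by3 in g3 g4.
  have d0 := dF x y vx xy.
  have hx := ler_wpM2r d0 (hr_le x vx xV).
  (* Equality of the densities is known only above [v]; if [y = v], then [x = y] and both sides
     vanish. *)
  have hy : (p (al y) + q (be y)) * (x^-1 - y^-1) <= hr y * (x^-1 - y^-1).
    move: vy; rewrite le_eqVlt => /predU1P[vy|vy]; last by rewrite hr_eq.
    have -> : x = y by apply/eqP; rewrite eq_le xy -vy vx.
    by rewrite subrr !mulr0.
  by rewrite /Q; apply/andP; split; lra.
have := sandwich_unique vVle cF ndhr sP sQ.
rewrite P0/= subr0 => PV; rewrite fP// PV; congr EFin.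
have [_ _ al1] := alP v (lexx v) vVle.
(* [Q v = 0], and the product [p x * q x] inside [G2] leaves two boundary terms: [v ^- 2] at [w] and
   [(V * lm b)^-1] at [b]. *)
rewrite /Q /al /be lexx (lt_geF vV) aV bV/= /G2 /p /q lpb lpw lmw expr2 !invfM.
by ring.
Qed.

End on_subinterval.

(** * The level at which Phi takes the value VW^-2 *)

Local Notation VL := (VL Im Ip lm lp).

(** Strictly between [v] and [Vm] both inverses lie in the open interval, where the rates are
    positive. *)
Lemma Phi_density_fin V : v < V -> V < Vm -> exists2 H : R, 0 < H & h V = H%:E.
Proof.
move=> vV VVm; have [a [aV Ima _]] := lm_inv_real vV VVm.
have [b [bV bIp _]] := lp_inv_real vV VVm.
have ab := inv_lt vV (ltW VVm) aV bV.
have lpa : 0 < lp a%:E by apply: lp_gt0 => //; apply: lt_trans bIp; rewrite lte_fin.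
have lmb : 0 < lm b%:E by apply: lm_gt0 => //; apply: lt_trans Ima _; rewrite lte_fin.
exists ((lp a%:E)^-1 + (lm b%:E)^-1); first by rewrite addr_gt0 ?invr_gt0.
exact: Phi_density_EFin.
Qed.

(** The density is positive at [V], so [Phi] exceeds the finite value [v ^- 2] at every higher
    level. *)
Lemma VL_unique V : v <= V -> V <= Vm -> Phi V = (v ^- 2)%:E -> VL = V.
Proof.
move=> vV VVm PV; have v0 := VW_gt0; have [_ PS] := Phi_sandwich.
have VS : V \in `[v, Vm] /\ (Phi V <= (v ^- 2)%:E)%E by rewrite in_itv/= vV VVm PV.
apply/eqP; rewrite eq_le; apply/andP; split; last first.
  apply: ub_le_sup => //; exists Vm => x [+ _].
  by rewrite in_itv/= => /andP[].
apply: ge_sup; first by exists V.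
move=> V' [+ PV']; rewrite in_itv/= => /andP[vV' V'Vm]; rewrite leNgt; apply/negP => VV'.
have [+ _] := PS _ _ vV (ltW VV') V'Vm; rewrite PV => /le_trans/(_ PV').
rewrite leNgt lteDl// mule_gt0//.
  by apply: Phi_density_gt0; rewrite in_itv/= vV.
by rewrite lte_fin subr_gt0 ltf_pV2 ?posrE//; exact: lt_le_trans v0 _.
Qed.

(** Near [VL] a finite density bounds the increments of [Phi], which therefore cannot jump across
    [v ^- 2]. *)
Lemma VL_Phi : VL < Vm -> v < VL /\ Phi VL = (v ^- 2)%:E.
Proof.
move=> LVm; have v0 := VW_gt0; have [P0 PS] := Phi_sandwich.
have v2 : 0 < v ^+ 2 by rewrite exprn_gt0.
set L := VL in LVm *.
have Sub : has_ubound [set V : R | V \in `[v, Vm] /\ (Phi V <= (v ^- 2)%:E)%E].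
  by exists Vm => x [+ _]; rewrite in_itv/= => /andP[].
have Sv : [set V : R | V \in `[v, Vm] /\ (Phi V <= (v ^- 2)%:E)%E] v.
  by rewrite /= in_itv/= lexx ltW// P0 lee_fin invr_ge0 ltW.
have vL : v <= L by apply: ub_le_sup.
have inv_sub x y : v <= x -> x <= y -> x^-1 - y^-1 <= (y - x) / v ^+ 2.
  move=> vx xy; have x0 := lt_le_trans v0 vx; have y0 := lt_le_trans x0 xy.
  have -> : x^-1 - y^-1 = (y - x) * (x * y)^-1 by field; rewrite !gt_eqF.
  apply: ler_wpM2l; first by rewrite subr_ge0.
  rewrite lef_pV2 ?posrE ?mulr_gt0// expr2.
  by apply: ler_pM => //; [exact: ltW|exact: ltW|exact: le_trans xy].
(* This gives [v < L] because [Phi v = 0], and the upper bound needs [v < L] for a finite density at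
   [L]. *)
suff lower : ~ (Phi L < (v ^- 2)%:E)%E.
  have vL' : v < L.
    rewrite lt_neqAle vL andbT; apply/eqP => e; apply: lower.
    by rewrite -e P0 lte_fin invr_gt0.
  split => //; apply/eqP; rewrite eq_le; apply/andP; split; last by rewrite leNgt; apply/negP.
  rewrite leNgt; apply/negP.
  have [H H0 hL] := Phi_density_fin vL' LVm.
  have fL : Phi L \is a fin_num.
    rewrite ge0_fin_numE; last by apply: Phi_ge0 => //; exact: ltW.
    have [_] := PS _ _ (lexx v) vL (ltW LVm).
    by rewrite P0 add0e hL -EFinM => /le_lt_trans; apply; rewrite ltry.
  move: PS; rewrite -(fineK fL); set r := fine _ => PS; rewrite lte_fin => gap.
  (* Over a distance below this one, [Phi] varies by less than the gap [r - v ^- 2]: its slope is at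
     most [H / v ^+ 2]. *)
  have d0 : 0 < (r - v ^- 2) * v ^+ 2 / H by rewrite divr_gt0// mulr_gt0// subr_gt0.
  have [V [VI PV] LV] := sup_adherent d0 (conj (ex_intro _ v Sv) Sub).
  move: (VI); rewrite in_itv/= => /andP[vV VVm].
  have VL' : V <= L by apply: ub_le_sup.
  have [_] := PS _ _ vV VL' (ltW LVm).
  rewrite -(fineK fL) -/r hL -EFinM => h1.
  have : (r%:E <= (v ^- 2)%:E + (H * (V^-1 - L^-1))%:E)%E by apply: le_trans h1 _; exact: leeD.
  rewrite -EFinD lee_fin; apply/negP; rewrite -ltNge.
  have h2 : H * (V^-1 - L^-1) <= H * ((L - V) / v ^+ 2) by apply: ler_wpM2l; [exact: ltW|exact: inv_sub].
  have h3 : L - V < (r - v ^- 2) * v ^+ 2 / H by rewrite -/VL -/L in LV; lra.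
  have h4 : H * ((L - V) / v ^+ 2) < r - v ^- 2.
    by move: h3; rewrite ltr_pdivlMr// mulrA ltr_pdivrMr// mulrC.
  by lra.
move=> gap.
(* Any level strictly between [L] and [Vm] would do: the density there is finite and bounds the
   density on its left. *)
pose V' := (L + Vm) / 2.
have LV' : L < V' by rewrite /V'; lra.
have V'Vm : V' < Vm by rewrite /V'; lra.
have [H H0 hV'] := Phi_density_fin (le_lt_trans vL LV') V'Vm.
have fL : Phi L \is a fin_num.
  rewrite ge0_fin_numE; first by apply: lt_trans gap _; rewrite ltry.
  by apply: Phi_ge0 => //; exact: ltW.
move: gap; rewrite -(fineK fL) lte_fin; set r := fine _ => gap.
pose d := (v ^- 2 - r) * v ^+ 2 / H.
have d0 : 0 < d by rewrite divr_gt0// mulr_gt0// subr_gt0.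
pose V := Num.min V' (L + d).
have LV : L < V by rewrite lt_min LV' ltrDl.
have VV' : V <= V' by rewrite ge_min lexx.
have VVm : V <= Vm := le_trans VV' (ltW V'Vm).
have vV := le_trans vL (ltW LV).
suff : V <= L by rewrite leNgt LV.
apply: ub_le_sup => //; split; first by rewrite in_itv/= vV.
have [_] := PS _ _ vL (ltW LV) VVm; move=> /le_trans; apply.
rewrite -(fineK fL) -/r.
have D0 : 0 <= L^-1 - V^-1.
  have V0 := lt_le_trans v0 vV; have L0 := lt_le_trans v0 vL.
  by rewrite subr_ge0 lef_pV2 ?posrE//; exact: ltW.
have h1 : (h V * (L^-1 - V^-1)%:E <= (H * (L^-1 - V^-1))%:E)%E.
  rewrite EFinM -hV'; apply: lee_wpmul2r; first by rewrite lee_fin.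
  apply: Phi_density_nondec => //; rewrite in_itv/= ?vV ?VVm//.
  by rewrite (le_trans vV VV') (ltW V'Vm).
apply: (@le_trans _ _ (r%:E + (H * (L^-1 - V^-1))%:E)%E); first exact: leeD.
rewrite -EFinD lee_fin.
have h2 : H * (L^-1 - V^-1) <= H * ((V - L) / v ^+ 2).
  by apply: ler_wpM2l; [exact: ltW|apply: inv_sub => //; exact: ltW].
have h3 : V - L <= d by rewrite lerBlDl ge_min lexx orbT.
have h4 : H * ((V - L) / v ^+ 2) <= v ^- 2 - r.
  by move: h3; rewrite /d ler_pdivlMr// mulrA ler_pdivrMr// mulrC.
by lra.
Qed.

End competitive_window.

(** * The window at level VL, and why no other interval qualifies *)

Theorem lemma6 (R : realType) (Im Ip : \bar R) (lm lp : \bar R -> R)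
  (I_nonempty : (Im < Ip)%E)
  (lm_ge0 : forall x : \bar R, x \in `[Im, Ip] -> 0 <= lm x)
  (lp_ge0 : forall x : \bar R, x \in `[Im, Ip] -> 0 <= lp x)
  (lm_cont : {within `[Im, Ip], continuous lm})
  (lp_cont : {within `[Im, Ip], continuous lp})
  (lm_noninc : forall x y : \bar R, x \in `[Im, Ip] -> y \in `[Im, Ip] ->
     (x <= y)%E -> lm y <= lm x)
  (lp_nondec : forall x y : \bar R, x \in `[Im, Ip] -> y \in `[Im, Ip] ->
     (x <= y)%E -> lp x <= lp y)
  (lm_gt0 : forall x : R, (Im < x%:E)%E -> (x%:E < Ip)%E -> 0 < lm x%:E)
  (lp_gt0 : forall x : R, (Im < x%:E)%E -> (x%:E < Ip)%E -> 0 < lp x%:E)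
  (VW_lt_Vmax : VW Im Ip lm lp < Vmax Im Ip lm lp)
  (VL_lt_Vmax : VL Im Ip lm lp < Vmax Im Ip lm lp) :
  exists J : R * R,
    unique (fun J : R * R =>
      [/\ J.1 < J.2,
          (Im < J.1%:E)%E /\ (J.2%:E < Ip)%E,
          exists fm fp : R -> R,
            [/\ luckock_solution (lm \o EFin) (lp \o EFin) J.1 J.2 fm fp,
                forall gm gp : R -> R,
                  luckock_solution (lm \o EFin) (lp \o EFin) J.1 J.2 gm gp ->
                  forall x : R, x \in `[J.1, J.2] ->
                    gm x = fm x /\ gp x = fp x,
                fm J.1 = 0 &
                fp J.2 = 0],
          (forall x : R, x \in `]J.1, J.2] -> lm x%:E < lm J.1%:E) &
          (forall x : R, x \in `[J.1, J.2[ -> lp x%:E < lp J.2%:E)]) J /\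
    competitive_window Im Ip lm lp = (J.1%:E, J.2%:E).
Proof.
have sandwich (a b : R) : a < b -> (Im < a%:E)%E -> (b%:E < Ip)%E ->
    exists G, stieltjes_sandwich a b (fun x => (lp x%:E)^-1) (fun x => (lm x%:E)^-1) G.
  move=> ab Ima bIp.
  have pos := subinterval_gt0 lm_gt0 lp_gt0 Ima bIp.
  have clm := subinterval_continuous Ima bIp lm_cont.
  have clp := subinterval_continuous Ima bIp lp_cont.
  have lm0 x : a <= x -> x <= b -> 0 < lm x%:E by move=> ax xb; have [] := pos x ax xb.
  have lp0 x : a <= x -> x <= b -> 0 < lp x%:E by move=> ax xb; have [] := pos x ax xb.
  apply: (stieltjes_sandwich_exists (ltW ab)).
  - exact: (within_continuousV clp lp0).
  - exact: (within_continuousV clm lm0).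
  - move=> x y xab yab xy; have := xab; have := yab.
    rewrite !in_itv/= => /andP[ay yb] /andP[ax xb].
    by rewrite lef_pV2 ?posrE ?lp0//; exact: (subinterval_nondec lp_nondec Ima bIp).
  - exact: (homo_rateV_lm lm0 (subinterval_noninc lm_noninc Ima bIp)).
have [vL PL] := VL_Phi I_nonempty lm_ge0 lp_ge0 lm_cont lp_cont lm_noninc lp_nondec
  lm_gt0 lp_gt0 VW_lt_Vmax VL_lt_Vmax.
have [a [aE Ima lma]] := lm_inv_real I_nonempty lm_cont lp_cont lm_noninc lp_nondec
  VW_lt_Vmax vL VL_lt_Vmax.
have [b [bE bIp lpb]] := lp_inv_real I_nonempty lm_cont lp_cont lm_noninc lp_nondec
  VW_lt_Vmax vL VL_lt_Vmax.
have ab := inv_lt I_nonempty lm_cont lp_cont lm_noninc lp_nondec VW_lt_Vmax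
  vL (ltW VL_lt_Vmax) aE bE.
exists (a, b); split; last by rewrite /competitive_window aE bE.
split.
  have [G sG] := sandwich a b ab Ima bIp.
  have := Phi_formula I_nonempty lm_ge0 lp_ge0 lm_cont lp_cont lm_noninc lp_nondec
    lm_gt0 lp_gt0 VW_lt_Vmax Ima bIp vL (ltW VL_lt_Vmax) aE bE sG.
  rewrite PL => -[Phi_eq].
  (* The two terms VW^-2 cancel, leaving exactly the solvability condition of
     [luckock_solution_exists]. *)
  have GE : G b - G a = (VL Im Ip lm lp * lm b%:E)^-1 by move: Phi_eq; lra.
  have pos := subinterval_gt0 lm_gt0 lp_gt0 Ima bIp.
  have lm0 x : a <= x -> x <= b -> 0 < (lm \o EFin) x by move=> ax xb; have [] := pos x ax xb.
  have lp0 x : a <= x -> x <= b -> 0 < (lp \o EFin) x by move=> ax xb; have [] := pos x ax xb.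
  have clm := subinterval_continuous Ima bIp lm_cont.
  have clp := subinterval_continuous Ima bIp lp_cont.
  have nilm := subinterval_noninc lm_noninc Ima bIp.
  have ndlp := subinterval_nondec lp_nondec Ima bIp.
  have L0 : 0 < VL Im Ip lm lp by rewrite -lma; exact: (lm0 a (lexx a) (ltW ab)).
  have [fm [fp [sol fma fpb]]] :=
    luckock_solution_exists ab clm clp lm0 lp0 nilm ndlp sG L0 lma lpb GE.
  split => //=.
  - exists fm, fp; split => // gm gp solg x xab.
    exact: (luckock_solution_unique ab clm clp lm0 lp0 nilm ndlp sG sol solg).
  - move=> x xab; rewrite lma ltNge; apply/negP => Lx.
    have := xab; rewrite in_itv/= => /andP[ax xb].
    suff : (x%:E <= a%:E)%E by rewrite lee_fin leNgt ax.
    rewrite -aE; apply: ereal_sup_ubound; split => //.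
    by apply: (subinterval_itv Ima bIp); rewrite in_itv/= (ltW ax).
  - move=> x xab; rewrite lpb ltNge; apply/negP => Lx.
    have := xab; rewrite in_itv/= => /andP[ax xb].
    suff : (b%:E <= x%:E)%E by rewrite lee_fin leNgt xb.
    rewrite -bE; apply: ereal_inf_lbound; split => //.
    by apply: (subinterval_itv Ima bIp); rewrite in_itv/= (ltW xb) ax.
move=> [a' b'] /= [ab' [Ima' bIp'] [fm [fp [sol _ fma fpb]]] lma' lpb'].
have [G sG] := sandwich a' b' ab' Ima' bIp'.
have pos := subinterval_gt0 lm_gt0 lp_gt0 Ima' bIp'.
have lm0 x : a' <= x -> x <= b' -> 0 < (lm \o EFin) x by move=> ax xb; have [] := pos x ax xb.
have lp0 x : a' <= x -> x <= b' -> 0 < (lp \o EFin) x by move=> ax xb; have [] := pos x ax xb.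
have clm := subinterval_continuous Ima' bIp' lm_cont.
have clp := subinterval_continuous Ima' bIp' lp_cont.
have nilm := subinterval_noninc lm_noninc Ima' bIp'.
have ndlp := subinterval_nondec lp_nondec Ima' bIp'.
have [/= lmlp GE] := luckock_solution_zero ab' clm clp lm0 lp0 nilm ndlp sG sol fma fpb.
pose V := lm a'%:E.
have aI : a'%:E \in `[Im, Ip].
  by apply: (subinterval_itv Ima' bIp'); rewrite in_itv/= lexx ltW.
have bI : b'%:E \in `[Im, Ip].
  by apply: (subinterval_itv Ima' bIp'); rewrite in_itv/= lexx ltW.
(* Monotonicity extends (ii) beyond the subinterval, so [a'] is the last point where [lm] reaches
   [V]; [lt_lp] does the same for [b']. *)
have lt_lm x : x \in `[Im, Ip] -> (a'%:E < x)%E -> lm x < V.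
  move=> xI ax; case: (leP x b'%:E) => [xb|bx]; last first.
    apply: (@le_lt_trans _ _ (lm b'%:E)); first exact: lm_noninc (ltW bx).
    by apply: lma'; rewrite in_itv/= ab' lexx.
  case: x xI ax xb => [x| |] // xI ax xb.
  by apply: lma'; rewrite in_itv/= -lte_fin ax -lee_fin.
have lt_lp x : x \in `[Im, Ip] -> (x < b'%:E)%E -> lp x < V.
  move=> xI xb; rewrite /V lmlp; case: (leP a'%:E x) => [ax|xa]; last first.
    apply: (@le_lt_trans _ _ (lp a'%:E)); first exact: lp_nondec (ltW xa).
    by apply: lpb'; rewrite in_itv/= ab' lexx.
  case: x xI ax xb => [x| |] // xI ax xb.
  by apply: lpb'; rewrite in_itv/= -lee_fin ax -lte_fin.
have aV : lm_inv Im Ip lm V = a'%:E.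
  apply/eqP; rewrite eq_le; apply/andP; split; last by apply: ereal_sup_ubound; split.
  apply: ge_ereal_sup => x [xI Vx]; rewrite leNgt; apply/negP => /(lt_lm x xI).
  by rewrite ltNge Vx.
have bV : lp_inv Im Ip lp V = b'%:E.
  apply/eqP; rewrite eq_le; apply/andP; split.
    by apply: ereal_inf_lbound; split => //; rewrite /V lmlp.
  apply: le_ereal_inf_tmp => x [xI Vx]; rewrite leNgt; apply/negP => /(lt_lp x xI).
  by rewrite ltNge Vx.
have ImI : Im \in `[Im, Ip] by rewrite in_itv/= lexx ltW.
have IpI : Ip \in `[Im, Ip] by rewrite in_itv/= lexx ltW.
have VVm : V <= Vmax Im Ip lm lp.
  rewrite /Vmax le_min; apply/andP; split.
    by apply: lm_noninc => //; exact: ltW.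
  by rewrite /V lmlp; apply: lp_nondec => //; exact: ltW.
(* The crossing point lies right of [a'] or left of [b']; in either case one of the strict
   inequalities puts its level below [V]. *)
have vV : VW Im Ip lm lp < V.
  have [w [Imw wIp lmw lpw]] := lm_lp_crossing I_nonempty lm_cont lp_cont lm_noninc
    lp_nondec VW_lt_Vmax.
  have wI : w%:E \in `[Im, Ip] by rewrite in_itv/= !ltW.
  case: (leP w a') => wa; last by rewrite -lmw lt_lm ?lte_fin.
  by rewrite -lpw lt_lp// lte_fin (le_lt_trans wa).
have PV := Phi_formula I_nonempty lm_ge0 lp_ge0 lm_cont lp_cont lm_noninc lp_nondec
    lm_gt0 lp_gt0 VW_lt_Vmax Ima' bIp' vV VVm aV bV sG.
have VLV : VL Im Ip lm lp = V.
  apply: (VL_unique I_nonempty lm_ge0 lp_ge0 lm_cont lp_cont lm_noninc lp_nondec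
    lm_gt0 VW_lt_Vmax (ltW vV) VVm).
  by rewrite PV GE subrr add0r.
have ea : a = a' by apply: EFin_inj; rewrite -aE VLV.
have eb : b = b' by apply: EFin_inj; rewrite -bE VLV.
by rewrite ea eb.
Qed.
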